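(* Let $m\ge2$ be an integer, $0<r<1$, $G=\{z\in\mathbb{C}:|z^m-1|<r^m\}$, and let $\lambda_n$ be the (positive) leading coefficient of the $n$-th orthonormal Bergman polynomial of $G$. For each $s=0,1,\ldots,m-1$ there holds $$\lim_{k\to\infty}\lambda_{km+s}\,r^{km+s+1}\sqrt{\frac{\pi}{km+s+1}}=\frac{1}{r^{m-s-1}}.$$
   Context: The Bergman polynomials $P_n(z)=\lambda_nz^n+\cdots$, $\lambda_n>0$, $n=0,1,2,\ldots$, of $G$ are the polynomials obtained by orthonormalizing $1,z,z^2,\ldots$ with respect to $\int_Gf\,\overline{g}\,dA$, where $dA$ is area measure. *)

(* Defs.v *)
From HB Require Import structures.
From mathcomp Require Import all_boot all_order all_algebra.
From mathcomp Require Import complex.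
From mathcomp Require Import all_classical all_reals all_analysis.

Set Implicit Arguments.
Unset Strict Implicit.
Unset Printing Implicit Defensive.

Import Order.TTheory GRing.Theory Num.Theory.
Import numFieldNormedType.Exports.

Local Open Scope classical_set_scope.
Local Open Scope complex_scope.
Local Open Scope ring_scope.

Section Bergman.
Context {R : realType}.

(* Area measure on C, with C identified with R * R via (x, y) |-> x + i y. *)
Definition area_measure : set (measurableTypeR R * measurableTypeR R) -> \bar R :=
  (@lebesgue_measure R \x @lebesgue_measure R)%E.

HB.instance Definition _ := Measure.on area_measure.

Definition area_integral (G : set R[i]) (f : R[i] -> R[i]) : R[i] :=
  let D := [set p : measurableTypeR R * measurableTypeR R | G (p.1 +i* p.2)] in
  (\int[area_measure]_(p in D) complex.Re (f (p.1 +i* p.2)))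
  +i* (\int[area_measure]_(p in D) complex.Im (f (p.1 +i* p.2))).

Definition bergman_dot (G : set R[i]) (f g : R[i] -> R[i]) : R[i] :=
  area_integral G (fun z => f z * (g z)^*%C).

(* In R[i], [0 < z] means that z is real and positive. *)
Definition bergman_polynomials (G : set R[i]) (P : nat -> {poly R[i]}) : Prop :=
  [/\ forall n, size (P n) = n.+1,
      forall n, 0 < lead_coef (P n) &
      forall j n, bergman_dot G (horner (P j)) (horner (P n)) = (j == n)%:R].

Definition bergman_leading_coef (P : nat -> {poly R[i]}) (n : nat) : R :=
  complex.Re (lead_coef (P n)).

Definition lemniscate_domain (m : nat) (r : R) : set R[i] :=
  [set z | `|z ^+ m - 1| < (r ^+ m)%:C].

End Bergman.

(* Main.v *)
(* The number [lambda_n ^ -2] is the minimum of the integral of [|q|^2] over [G]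
   among monic [q] of degree [n = k m + s].  The symmetry of [G] under the [m]-th
   roots of unity allows one to take [q z = z ^ s * Q (z ^ m)], and [w = z ^ m]
   turns this integral into [1 / m] times the integral of
   [|Q w|^2 |w| ^ (- 2 p / m)] over the disk [|w - 1| < rho], where [rho = r ^ m]
   and [p = m - s - 1].  With [w = 1 + v], the weight [|1 + v| ^ (- 2 p / m)] is up
   to a factor close to [1] the squared modulus of a truncated binomial series [U]
   with [U 0 = 1].
   Lower bound: if [Q] is monic of degree [k] in [v], then the mean of [|Q U|^2] on
   the circle of radius [|v|] is at least [|v| ^ (2 k)], so the minimum is at least
   [pi * rho ^ (2 (k + 1)) / (m (k + 1))].
   Upper bound: take [Q v = v ^ k * T (rho ^ 2 / v)], with [T] the truncated series
   of [(1 + x) ^ (p / m)].  The mass concentrates near [|v| = rho], where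
   [rho ^ 2 / v] is close to the conjugate of [v], so that [T] cancels the weight. *)
From HB Require Import structures.
Require Import Defs.
From mathcomp Require Import all_boot all_order all_algebra.
From mathcomp Require Import complex.
From mathcomp Require Import all_classical all_reals all_analysis.
From mathcomp Require Import measurable_realfun zify ring lra.

Set Implicit Arguments.
Unset Strict Implicit.
Unset Printing Implicit Defensive.

Import Order.TTheory GRing.Theory Num.Theory.
Import numFieldNormedType.Exports.

Local Open Scope classical_set_scope.
Local Open Scope ring_scope.

(** * Changes of variables on the real line *)

(** Complex analysis is avoided altogether: no contour integral, no holomorphic fractional power.
    Three devices replace it. (1) Every area integral that has to be transformed or estimated has a
    nonnegative integrand built from [normc2], is taken over the whole plane with values in
    [\bar R], and is reduced by Tonelli to substitutions on the line. Integrability matters only for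
    the linearity of the inner product. (2) The mean over a circle becomes a finite average over the
    [M]-th roots of unity, which isolates a coefficient exactly as soon as [M] exceeds the degrees
    involved. The same identity with [M = m] and [U = 1] extracts the exponents congruent to [s]
    modulo [m]. (3) The weight |w|^(-2p/m) is only ever compared through its [m]-th power, which is
    an integer power; the truncated series is also raised to the power [m], and it is controlled by
    the differential equation of (1 + X)^b, read on coefficients. Since |w - 1| < rho < 1 keeps w
    away from 0, the errors can be made relative: all comparisons hold up to powers of 1 + d, with d
    arbitrary. *)

Section weighted_pushforward.
Local Open Scope ereal_scope.
Context d1 d2 (X : measurableType d1) (Y : measurableType d2) (R : realType).
Variables (mu : {measure set X -> \bar R}) (nu : {measure set Y -> \bar R}).
Variables (D : set X) (phi : X -> Y) (w : X -> R).
Hypotheses (mD : measurable D) (mphi : measurable_fun D phi).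
Hypotheses (mw : measurable_fun D w) (w0 : forall x, D x -> (0 <= w x)%R).
Hypothesis nuE : forall A, measurable A ->
  \int[mu]_(x in D `&` phi @^-1` A) (w x)%:E = nu A.

Import HBNNSimple.

(** Monotone convergence on both sides reduces the claim to simple functions, which are finite
    combinations of indicators of level sets; on one level set the claim is [nuE]. *)
Lemma ge0_integral_weighted_pushforward (f : Y -> \bar R) :
  measurable_fun setT f -> (forall y, 0 <= f y) ->
  \int[mu]_(x in D) (f (phi x) * (w x)%:E) = \int[nu]_y f y.
Proof.
move=> mf f0.
pose f_ := nnsfun_approx measurableT mf.
have f_cvg y : EFin \o f_ ^~ y @ \oo --> f y.
  by apply: cvg_nnsfun_approx => // *; exact: f0.
have mf_phi n : measurable_fun D (f_ n \o phi).
  by apply: measurableT_comp => //.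
transitivity (limn (fun n => \int[mu]_(x in D) (f_ n (phi x) * w x)%:E)).
  rewrite -monotone_convergence//.
  - apply: eq_integral => x /[!inE] Dx; apply/esym/cvg_lim => //.
    under eq_fun do rewrite EFinM.
    apply: cvgeZr => //.
    exact: f_cvg.
  - by move=> n; apply/measurable_EFinP/measurable_funM; [exact: mf_phi|exact: mw].
  - by move=> n x Dx; rewrite lee_fin mulr_ge0// w0.
  - move=> x Dx m n mn; rewrite lee_fin ler_wpM2r ?w0//.
    exact/lefP/nd_nnsfun_approx.
transitivity (limn (fun n => \int[nu]_y (f_ n y)%:E)); last first.
  rewrite -monotone_convergence//.
  - by apply: eq_integral => y _; apply/cvg_lim => //; exact: f_cvg.
  - by move=> n; exact/measurable_EFinP/measurable_funP.
  - by move=> n y _; rewrite lee_fin.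
  - by move=> y _ m n mn; rewrite lee_fin; exact/lefP/nd_nnsfun_approx.
congr (limn _); apply/funext => n.
rewrite integralT_nnsfun sintegralE.
transitivity (\int[mu]_(x in D) \sum_(k \in range (f_ n))
    (k * \1_(f_ n @^-1` [set k]) (phi x) * w x)%:E).
  apply: eq_integral => x _.
  rewrite fsumEFin//; congr EFin; rewrite {1}(fimfunE (f_ n) (phi x)).
  by rewrite !fsbig_finite//= mulr_suml.
have mind k : measurable_fun D (fun x => \1_(f_ n @^-1` [set k]) (phi x) : R).
  apply: (@measurableT_comp _ _ _ _ _ _ (\1_(f_ n @^-1` [set k]) : Y -> R)) => //.
rewrite ge0_integral_fsum//; last 2 first.
- move=> k; apply/measurable_EFinP/measurable_funM => //.
  by apply: measurable_funM => //.
- move=> k x Dx; rewrite lee_fin mulr_ge0 ?w0//.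
  by rewrite -lee_fin nnfun_muleindic_ge0.
apply: eq_fsbigr => k /[!inE] -[y _ yk].
under eq_integral do rewrite -mulrA EFinM.
rewrite ge0_integralZl_EFin//; last 3 first.
- by move=> x Dx; rewrite lee_fin mulr_ge0 ?w0.
- by apply/measurable_EFinP/measurable_funM.
- by rewrite -yk.
congr (_ * _); rewrite -nuE// integral_mkcondr.
apply: eq_integral => x _; rewrite patchE.
rewrite indicE (_ : (x \in phi @^-1` _) = (phi x \in f_ n @^-1` [set k]))//.
by case: (_ \in _); rewrite ?mul1r ?mul0r.
Qed.

End weighted_pushforward.

Section substitution.
Local Open Scope ereal_scope.
Context {R : realType}.
Notation mu := (@lebesgue_measure R).

(* All substitutions are arranged so that [F] is onto the real line: then the
   image of an interval needs no endpoint analysis. *)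
Lemma ge0_integration_by_substitution_onto (D : set R) (F F' G : R -> R)
    (f : R -> \bar R) :
  measurable D ->
  (forall y, D (G y)) -> (forall y, F (G y) = y) ->
  (forall x y, D x -> D y -> (F x < F y)%R = (x < y)%R) ->
  (forall x y z, D x -> D y -> (x <= z <= y)%R -> D z) ->
  (forall x, D x -> is_derive x 1%R F (F' x)) ->
  (forall x, D x -> {for x, continuous F'}) ->
  (forall x, D x -> (0 <= F' x)%R) ->
  measurable_fun D F -> measurable_fun D F' ->
  measurable_fun setT f -> (forall y, 0 <= f y) ->
  \int[mu]_(x in D) (f (F x) * (F' x)%:E) = \int[mu]_y f y.
Proof.
move=> mD GD FG Fmono Dconv dF cF' F'0 mF mF' mf f0.
(* The image under [F] of the measure with density [F'] on [D]. Once it is identified with Lebesgue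
   measure, the weighted pushforward formula concludes. *)
pose nu (A : set (measurableTypeR R)) : \bar R := \int[mu]_(x in D `&` F @^-1` A) (F' x)%:E.
have nu_set0 : nu set0 = 0 by rewrite /nu preimage_set0 setI0 integral_set0.
have nu_ge0 A : 0 <= nu A by apply: integral_ge0 => x [Dx _]; rewrite lee_fin F'0.
have mDF (A : set (measurableTypeR R)) : measurable A -> measurable (D `&` F @^-1` A) by exact: mF.
have nu_sigma : semi_sigma_additive nu.
  move=> A mA tA mUA.
  (* Extending the density by 0 makes it nonnegative and measurable everywhere, as the additivity of
     an induced measure requires. *)
  pose w := (fun x => (F' x)%:E) \_ D.
  have mw : measurable_fun setT w.
    by apply/(measurable_restrictT _ mD)/measurable_EFinP.
  have w0 x : 0 <= w x.
    by rewrite /w patchE; case: ifPn => // /[!inE] Dx; rewrite lee_fin F'0.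
  have nuE B : nu B = \int[mu]_(x in D `&` F @^-1` B) w x.
    by apply: eq_integral => x /[!inE] -[Dx _]; rewrite /w patchE mem_set.
  rewrite nuE (_ : (fun n => _) = (fun n => \sum_(0 <= i < n)
      \int[mu]_(x in D `&` F @^-1` A i) w x)); last first.
    by apply/funext => n; apply: eq_bigr => i _; rewrite nuE.
  rewrite preimage_bigcup setI_bigcupr.
  apply: (@semi_sigma_additive_nng_induced _ (measurableTypeR R) R mu w mw w0
    (fun i => D `&` F @^-1` A i)).
  - by move=> i; exact: mDF.
  - apply/trivIsetP => i j _ _ ij; have /trivIsetP/(_ i j I I ij) Aij := tA.
    by rewrite setIACA setIid -preimage_setI Aij preimage_set0 setI0.
  - by rewrite -setI_bigcupr -preimage_bigcup; exact: mDF.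
pose nuM := isMeasure.Build _ _ _ nu nu_set0 nu_ge0 nu_sigma.
pose nu' : {measure set (measurableTypeR R) -> \bar R} := HB.pack nu nuM.
apply: etrans (_ : \int[nu']_y f y = _).
  exact: (@ge0_integral_weighted_pushforward _ _ _ _ _ mu nu').
apply: eq_measure_integral => A mA _; symmetry.
(* It suffices to measure half-open intervals. The preimage of []a, b]] is []G a, G b]], and the
   fundamental theorem of calculus gives F (G b) - F (G a) = b - a. *)
apply: lebesgue_measure_unique => // _ [[a b] _ <-] /=.
have [ba|ab] := leP b a.
  rewrite set_itv_ge ?measure0 ?bnd_simp -?leNgt//.
have Gab : (G a < G b)%R by rewrite -Fmono// !FG.
have -> : nu `]a, b]%classic = \int[mu]_(x in `]G a, G b]) (F' x)%:E.
  rewrite /nu; congr (integral _ _ _).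
  have Fle x y : D x -> D y -> (F x <= F y)%R = (x <= y)%R.
    by move=> Dx Dy; rewrite leNgt Fmono// -leNgt.
  apply/seteqP; split => x /=.
    move=> [Dx]; rewrite !in_itv/= => /andP[ax xb].
    by rewrite -Fmono// -Fle// !FG ax.
  rewrite in_itv/= => /andP[ax xb].
  have Dx : D x by apply: (Dconv (G a) (G b)) => //; rewrite (ltW ax).
  by split => //; rewrite in_itv/= -[X in (X < _)%R](FG a) -[X in (_ <= X)%R](FG b) Fmono// Fle// ax.
have Dab x : x \in `[G a, G b]%R -> D x.
  by rewrite in_itv/= => xab; exact: (Dconv (G a) (G b)).
have derF x : D x -> derivable F x 1%R by move=> /dF[].
have cF x : D x -> {for x, continuous F}.
  by move=> /derF /derivable1_diffP/differentiable_continuous.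
rewrite integral_itv_obnd_cbnd; last first.
  apply/measurable_EFinP; apply: measurable_funS mF' => //.
  by move=> x; rewrite /= in_itv/= => /andP[ax xb]; apply: Dab; rewrite in_itv/= (ltW ax).
rewrite (@continuous_FTC2 _ _ F)//.
- by rewrite !FG lebesgue_measure_itv/= lte_fin ab.
- by apply: continuous_in_subspaceT => x /[!inE] /Dab; exact: cF'.
- split.
  + by move=> x /subset_itv_oo_cc /Dab; exact: derF.
  + by apply: cvg_at_right_filter; apply: cF.
  + by apply: cvg_at_left_filter; apply: cF.
- by move=> x /subset_itv_oo_cc /Dab/dF; rewrite derive1E => -[].
Qed.

End substitution.

Section one_dimensional_substitutions.
Local Open Scope ereal_scope.
Context {R : realType}.
Notation mu := (@lebesgue_measure R).
Implicit Type f : R -> \bar R.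

Lemma ge0_integral_affine (c b : R) f : (0 < c)%R ->
  measurable_fun setT f -> (forall y, 0 <= f y) ->
  \int[mu]_x (f (c * x + b)%R * c%:E) = \int[mu]_y f y.
Proof.
move=> c0 mf f0.
apply: (@ge0_integration_by_substitution_onto _ setT (fun x => c * x + b)%R
  (fun=> c) (fun y => (y - b) / c)%R) => //.
- by move=> y; rewrite mulrCA divff ?gt_eqF// mulr1 subrK.
- by move=> x y _ _; rewrite ltrD2r ltr_pM2l.
- move=> x _.
  apply: (@is_derive_eq _ _ _ (c \*: (id : R -> R^o) + cst b)%R).
  by rewrite addr0 /GRing.scale/= mulr1.
- by move=> x _; exact: cst_continuous.
- by move=> x _; exact: ltW.
- by apply: measurable_funD => //; exact: mulrl_measurable.
Qed.

Lemma ge0_integral_translate (b : R) f :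
  measurable_fun setT f -> (forall y, 0 <= f y) ->
  \int[mu]_x f (x + b)%R = \int[mu]_y f y.
Proof.
move=> mf f0; rewrite -[RHS](@ge0_integral_affine 1 b)//.
by apply: eq_integral => x _; rewrite mul1r mule1.
Qed.

Lemma ge0_integralN f :
  measurable_fun setT f -> (forall y, 0 <= f y) ->
  \int[mu]_x f (- x)%R = \int[mu]_y f y.
Proof.
move=> mf f0.
transitivity (\int[pushforward mu (-%R : R -> measurableTypeR R)]_y f y).
  by rewrite ge0_integral_pushforward//; exact: oppr_measurable.
by apply: eq_measure_integral => /= A mA _; exact: lebesgue_measureN.
Qed.

Lemma ge0_integral_exp f :
  measurable_fun setT f -> (forall y, 0 <= f y) ->
  \int[mu]_(x in `]0%R, +oo[) f x = \int[mu]_t (f (expR t) * (expR t)%:E).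
Proof.
move=> mf f0.
(* The substitution is run through [ln], the map that is onto the line; the factor [expR t] then
   cancels the derivative 1 / x. *)
rewrite -[RHS](@ge0_integration_by_substitution_onto _ `]0%R, +oo[ (@ln R)
  (fun x => x^-1)%R (@expR R)) => //.
- apply: eq_integral => x; rewrite inE/= in_itv/= andbT => x0.
  by rewrite lnK// -muleA -EFinM divff ?gt_eqF// mule1.
- by move=> y; rewrite /= in_itv/= expR_gt0.
- exact: expRK.
- by move=> x y; rewrite /= !in_itv/= !andbT => x0 y0; rewrite ltr_ln.
- move=> x y z; rewrite /= !in_itv/= !andbT => x0 y0 /andP[xz _].
  exact: lt_le_trans xz.
- by move=> x; rewrite /= in_itv/= andbT => x0; exact: is_derive1_ln.
- move=> x; rewrite /= in_itv/= andbT => x0.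
  by apply: inv_continuous; rewrite gt_eqF.
- by move=> x; rewrite /= in_itv/= andbT => x0; rewrite invr_ge0 ltW.
- by apply: measurable_funTS; exact: measurable_ln.
- apply: open_continuous_measurable_fun => // x.
  rewrite inE/= in_itv/= andbT => x0.
  by apply: inv_continuous; rewrite gt_eqF.
- by apply: emeasurable_funM; [apply: measurableT_comp|apply/measurable_EFinP];
    (try exact: measurable_expR).
- by move=> t; rewrite mule_ge0// lee_fin expR_ge0.
Qed.

Lemma cos_gt0_itv (t : R) : t \in `](- (pi / 2))%R, (pi / 2)%R[ -> (0 < cos t)%R.
Proof. by rewrite in_itv/=; exact: cos_gt0_pihalf. Qed.

Lemma continuous_cosVX2 (t : R) : t \in `](- (pi / 2))%R, (pi / 2)%R[ ->
  {for t, continuous (fun t : R => (cos t) ^- 2)%R}.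
Proof.
move=> /cos_gt0_itv t0; apply: continuousV; first by rewrite expf_neq0 ?gt_eqF.
by apply: continuousM; exact: continuous_cos.
Qed.

Lemma ge0_integral_tan (x : R) f : (0 < x)%R ->
  measurable_fun setT f -> (forall y, 0 <= f y) ->
  \int[mu]_(t in `](- (pi / 2))%R, (pi / 2)%R[)
    (f (x * tan t)%R * (x * (cos t) ^- 2)%:E) = \int[mu]_y f y.
Proof.
move=> x0 mf f0.
have ct (t : R) : (t \in `](- (pi / 2)), (pi / 2)[)%R -> cos t != 0%R.
  by move=> /cos_gt0_itv; rewrite lt0r => /andP[].
have cC (t : R) : (t \in `](- (pi / 2)), (pi / 2)[)%R ->
    {for t, continuous (fun t : R => x * (cos t) ^- 2)%R}.
  move=> It; apply: continuousM; first exact: cst_continuous.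
  exact: continuous_cosVX2.
apply: (@ge0_integration_by_substitution_onto _ _ (fun t => x * tan t)%R _
  (fun y => atan (y / x))) => //.
- by move=> y; rewrite /= in_itv/= atan_gtNpi2 atan_ltpi2.
- by move=> y; rewrite atanK mulrCA divff ?gt_eqF// mulr1.
- by move=> t u Dt Du; rewrite ltr_pM2l// ltr_tan.
- move=> t u v; rewrite /= !in_itv/= => /andP[t1 t2] /andP[u1 u2] /andP[tv vu].
  by rewrite (lt_le_trans t1)// (le_lt_trans vu).
- move=> t /ct t0; have := is_derive_tan t0 => dt.
  by apply: is_deriveZ.
- by move=> t /cos_gt0_itv t0; rewrite mulr_ge0 ?(ltW x0)// invr_ge0 exprn_ge0// ltW.
- apply: open_continuous_measurable_fun => // t; rewrite inE => /ct t0.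
  by apply: continuousM; [exact: cst_continuous|exact: continuous_tan].
- by apply: open_continuous_measurable_fun => // t; rewrite inE; exact: cC.
Qed.

End one_dimensional_substitutions.

(** * Polar coordinates *)

Section log_polar_coordinates.
Local Open Scope ereal_scope.
Context {R : realType}.
Notation mu := (@lebesgue_measure R).
Notation plane := (measurableTypeR R * measurableTypeR R)%type.
Implicit Type f : plane -> \bar R.

(* The radius is [expR t], so that taking [m]-th powers in the plane becomes the
   affine substitution [(a, t) |-> (m a, m t)]. *)
Definition ray_integral f (a : R) : \bar R :=
  \int[mu]_t (f (expR t * cos a, expR t * sin a)%R * (expR t ^+ 2)%:E).

Let measurable_polar : measurable_fun setT
  (fun p : plane => (expR p.2 * cos p.1, expR p.2 * sin p.1)%R : plane).
Proof.
have me : measurable_fun setT (fun p : plane => expR p.2).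
  by apply: measurableT_comp; [exact: measurable_expR|exact: measurable_snd].
apply: measurable_fun_pair; apply: measurable_funM => //.
- apply: (@measurableT_comp _ _ _ _ _ _ (@cos R)) => //.
  by apply: continuous_measurable_fun; exact: continuous_cos.
- apply: (@measurableT_comp _ _ _ _ _ _ (@sin R)) => //.
  by apply: continuous_measurable_fun; exact: continuous_sin.
Qed.

Let measurable_polar_integrand f : measurable_fun setT f ->
  measurable_fun setT (fun p : plane =>
    f (expR p.2 * cos p.1, expR p.2 * sin p.1)%R * (expR p.2 ^+ 2)%:E).
Proof.
move=> mf; apply: emeasurable_funM.
  exact: measurableT_comp mf measurable_polar.
apply/measurable_EFinP/measurable_funX.
by apply: measurableT_comp; [exact: measurable_expR|exact: measurable_snd].
Qed.

Lemma measurable_ray_integrand f a : measurable_fun setT f ->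
  measurable_fun setT
    (fun t => f (expR t * cos a, expR t * sin a)%R * (expR t ^+ 2)%:E).
Proof.
move=> mf; apply: emeasurable_funM.
  apply: (measurableT_comp mf); apply: measurable_fun_pair;
    by apply: measurable_funM => //; exact: measurable_expR.
by apply/measurable_EFinP/measurable_funX; exact: measurable_expR.
Qed.

Lemma ray_integrand_ge0 f a t : (forall p, 0 <= f p) ->
  0 <= f (expR t * cos a, expR t * sin a)%R * (expR t ^+ 2)%:E.
Proof. by move=> f0; rewrite mule_ge0// lee_fin exprn_ge0// expR_ge0. Qed.

Lemma measurable_ray_integral f : measurable_fun setT f -> (forall p, 0 <= f p) ->
  measurable_fun setT (ray_integral f).
Proof.
move=> mf f0.
have g0 (p : plane) :
    0 <= f (expR p.2 * cos p.1, expR p.2 * sin p.1)%R * (expR p.2 ^+ 2)%:E.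
  exact: ray_integrand_ge0.
exact: (@measurable_fun_fubini_tonelli_F _ _ (measurableTypeR R)
  (measurableTypeR R) R mu _ (measurable_polar_integrand mf) g0).
Qed.

Lemma ray_integral_ge0 f a : (forall p, 0 <= f p) -> 0 <= ray_integral f a.
Proof.
by move=> f0; apply: integral_ge0 => t _; exact: ray_integrand_ge0.
Qed.

Lemma ray_integralD2pi f a : ray_integral f (a + pi *+ 2)%R = ray_integral f a.
Proof. by rewrite /ray_integral cosD2pi sinD2pi. Qed.

Lemma ge0_integral_plane f : measurable_fun setT f -> (forall p, 0 <= f p) ->
  \int[area_measure]_p f p = \int[mu]_x \int[mu]_y f (x, y).
Proof. by move=> mf f0; rewrite /area_measure fubini_tonelli1. Qed.

Local Notation I := (`](- (pi / 2))%R, (pi / 2)%R[%classic : set R).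

Let mem_pos_itv (x : R) : (x \in (`]0%R, +oo[%classic : set R)) = (0 < x)%R.
Proof. by apply/idP/idP; rewrite inE/= in_itv/= andbT. Qed.

(** For fixed x > 0 put y = x tan a, so dy = x / cos^2 a da; exchange the integrals; for fixed a put
    x = e^t cos a, so x dx / cos^2 a = e^(2t) dt. *)
Let half_plane f : measurable_fun setT f -> (forall p, 0 <= f p) ->
  \int[mu]_(x in `]0%R, +oo[) \int[mu]_y f (x, y) =
  \int[mu]_(a in I) ray_integral f a.
Proof.
move=> mf f0.
pose T : R -> R := @tan R \_ I.
pose C : R -> R := (fun a : R => (cos a) ^- 2)%R \_ I.
have mI : measurable I by exact: measurable_itv.
have mT : measurable_fun setT T.
  apply/(measurable_restrictT _ mI); apply: open_continuous_measurable_fun => // a.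
  by rewrite inE => /cos_gt0_itv a0; apply: continuous_tan; rewrite gt_eqF.
have mC : measurable_fun setT C.
  apply/(measurable_restrictT _ mI); apply: open_continuous_measurable_fun => // a.
  by rewrite inE; exact: continuous_cosVX2.
have C0 a : (0 <= C a)%R.
  rewrite /C patchE; case: ifPn => // /[!inE] /cos_gt0_itv a0.
  by rewrite invr_ge0 exprn_ge0// ltW.
have pt0 : (point : R) = 0%R by [].
(* [W] vanishes for x <= 0 and [T], [C] vanish off [I], so [k] is nonnegative on the whole plane and
   Tonelli applies without a restricted domain. *)
pose W (x : R) : R := Num.max x 0%R.
have W0 x : (0 <= W x)%R by rewrite le_max lexx orbT.
have mW : measurable_fun setT W by apply: measurable_maxr.
pose k (p : plane) := f (p.1, p.1 * T p.2)%R * (W p.1 * C p.2)%:E.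
have mxT : measurable_fun setT (fun p : plane => (p.1, p.1 * T p.2)%R : plane).
  apply: measurable_fun_pair => //; apply: measurable_funM => //.
  exact: measurableT_comp.
have mk : measurable_fun setT k.
  apply: emeasurable_funM; first exact: measurableT_comp mf mxT.
  by apply/measurable_EFinP/measurable_funM; apply: measurableT_comp.
have k0 p : 0 <= k p by rewrite mule_ge0// lee_fin mulr_ge0.
have mfx x : measurable_fun setT (fun y => f (x, y)).
  exact: measurableT_comp mf (measurable_pair1 _).
transitivity (\int[mu]_x \int[mu]_a k (x, a)).
  rewrite integral_mkcond; apply: eq_integral => x _; rewrite patchE.
  rewrite mem_pos_itv; case: ltP => x0.
    rewrite -(ge0_integral_tan x0 (mfx x))//.
    rewrite integral_mkcond; apply: eq_integral => a _.
    rewrite patchE /k /T /C/= !patchE; case: ifPn => _.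
      by rewrite /W max_l// ltW.
    by rewrite pt0 !mulr0 mule0.
  rewrite integral0_eq// => a _.
  by rewrite /k /W/= max_r// mul0r mule0.
transitivity (\int[mu]_a \int[mu]_x k (x, a)).
  exact: (@fubini_tonelli _ _ (measurableTypeR R) (measurableTypeR R) R mu mu k mk k0).
rewrite [RHS]integral_mkcond; apply: eq_integral => a _; rewrite patchE.
case: ifPn => [/[!inE] Ia|/negP nIa]; last first.
  rewrite integral0_eq// => x _.
  by rewrite /k /C/= patchE memNset ?pt0 ?mulr0 ?mule0// => Ia; apply: nIa; rewrite inE.
have ca := cos_gt0_itv Ia.
transitivity (\int[mu]_(x in `]0%R, +oo[) k (x, a)).
  rewrite [RHS]integral_mkcond; apply: eq_integral => x _; rewrite patchE.
  rewrite mem_pos_itv; case: ltP => // x0.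
  by rewrite /k /W/= max_r// mul0r mule0.
have mka : measurable_fun setT (fun x => k (x, a)).
  exact: measurableT_comp mk (measurable_pair2 _).
rewrite ge0_integral_exp//.
rewrite -(ge0_integral_translate (ln (cos a))); last 2 first.
- by apply: emeasurable_funM;
    [apply: (measurableT_comp mka)|apply/measurable_EFinP]; exact: measurable_expR.
- by move=> t; rewrite mule_ge0// lee_fin expR_ge0.
apply: eq_integral => t _.
rewrite expRD lnK// /k /= /T /C !patchE mem_set// -muleA -EFinM.
congr (f (_, _) * _%:E).
  by rewrite /tan; field; rewrite gt_eqF.
rewrite /W max_l ?mulr_ge0 ?expR_ge0// ?ltW//.
by field; rewrite gt_eqF.
Qed.

(** The left half-plane is the image of the right one under the point reflection p |-> -p, which
    adds [pi] to the angle. *)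
Lemma ge0_integral_log_polar_half f :
  measurable_fun setT f -> (forall p, 0 <= f p) ->
  \int[area_measure]_p f p =
  \int[mu]_(a in I) (ray_integral f a + ray_integral f (a + pi)%R).
Proof.
move=> mf f0; rewrite ge0_integral_plane//.
pose F x := \int[mu]_y f (x, y).
have mF : measurable_fun setT F.
  exact: (@measurable_fun_fubini_tonelli_F _ _ (measurableTypeR R)
    (measurableTypeR R) R mu _ mf f0).
have F0 x : 0 <= F x by exact: integral_ge0.
rewrite [RHS]ge0_integralD//; last 4 first.
- by move=> a _; exact: ray_integral_ge0.
- by apply: measurable_funTS; exact: measurable_ray_integral.
- by move=> a _; exact: ray_integral_ge0.
- apply: measurable_funTS.
  apply: (measurableT_comp (measurable_ray_integral mf f0)).
  exact: measurable_funD.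
rewrite -half_plane//.
pose fN (p : plane) := f (- p.1, - p.2)%R.
have mfN : measurable_fun setT fN.
  apply: (measurableT_comp mf); apply: measurable_fun_pair;
    by apply: measurableT_comp => //; exact: oppr_measurable.
have -> : \int[mu]_(a in I) ray_integral f (a + pi)%R = \int[mu]_(a in I) ray_integral fN a.
  apply: eq_integral => a _; apply: eq_integral => t _.
  by rewrite /fN/= cosDpi sinDpi !mulrN.
rewrite -half_plane//; last by move=> p; exact: f0.
have -> : \int[mu]_(x in `]0%R, +oo[) \int[mu]_y fN (x, y) =
    \int[mu]_(x in `]0%R, +oo[) F (- x)%R.
  apply: eq_integral => x _.
  rewrite /fN/= (ge0_integralN (f := fun y => f (- x, y)%R))//.
  exact: measurableT_comp mf (measurable_pair1 _).
have mFN : measurable_fun setT (F \o -%R).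
  by apply: (measurableT_comp mF); exact: oppr_measurable.
(* Adding the null endpoint 0 makes the reflected half-line exactly the complement of []0, +oo[]. *)
rewrite [X in _ + X]integral_itv_obnd_cbnd; last exact: measurable_funTS mFN.
rewrite (ge0_integration_by_substitution0 mFN)//.
under [X in _ = _ + X]eq_integral do rewrite /= opprK.
rewrite -{1}setC0 -(set_itvoc0 0%R) setCitv/= ge0_integral_setU//=; first last.
- rewrite disj_set2E; apply/eqP; rewrite -subset0 => x []/= /[!in_itv]/=.
  by rewrite leNgt andbT => /negP.
- by move=> x _; exact: F0.
- exact: measurable_funTS mF.
- by rewrite addeC.
- by move=> r; exact: F0.
Qed.

End log_polar_coordinates.

(** * Integrals of periodic functions, used for the angular variable *)

Section periodic_integrals.
Local Open Scope ereal_scope.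
Context {R : realType}.
Notation mu := (@lebesgue_measure R).
Variables (h : R -> \bar R).
Hypotheses (mh : measurable_fun setT h) (h0 : forall x, 0 <= h x).

Lemma ge0_integral_itvco_shift (a b c : R) :
  \int[mu]_(x in `[(a + c)%R, (b + c)%R[) h x =
  \int[mu]_(x in `[a, b[) h (x + c)%R.
Proof.
rewrite integral_mkcond -(ge0_integral_translate c); last 2 first.
- by apply/(measurable_restrictT _ (measurable_itv _)); exact: measurable_funTS.
- by move=> x; rewrite patchE; case: ifPn.
rewrite [RHS]integral_mkcond; apply: eq_integral => x _; rewrite !patchE.
congr (if _ then _ else _).
by apply/idP/idP; rewrite !inE/= !in_itv/= lerD2r ltrD2r.
Qed.

Lemma ge0_integral_itvco_split (a b c : R) : (a <= b)%R -> (b <= c)%R ->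
  \int[mu]_(x in `[a, c[) h x =
  \int[mu]_(x in `[a, b[) h x + \int[mu]_(x in `[b, c[) h x.
Proof.
move=> ab bc; rewrite -ge0_integral_setU//.
- by rewrite -itv_bndbnd_setU// bnd_simp.
- exact: measurable_funTS mh.
- rewrite disj_set2E; apply/eqP; rewrite -subset0 => x []/= /[!in_itv]/=.
  by move=> /andP[_ xb] /andP[bx _]; move: xb; rewrite ltNge bx.
Qed.

Variable T : R.
Hypotheses (T0 : (0 <= T)%R) (hT : forall x, h (x + T)%R = h x).

(** The two windows share [b, a + T[; the leftover [a, b[ is moved by one period onto [a + T, b +
    T[. *)
Lemma ge0_integral_period (a b : R) : (a <= b)%R -> (b <= a + T)%R ->
  \int[mu]_(x in `[a, (a + T)%R[) h x = \int[mu]_(x in `[b, (b + T)%R[) h x.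
Proof.
move=> ab baT.
rewrite (ge0_integral_itvco_split ab baT).
rewrite (@ge0_integral_itvco_split b (a + T)%R (b + T)%R) ?lerD2r//.
rewrite [LHS]addeC; congr (_ + _).
by rewrite ge0_integral_itvco_shift; apply: eq_integral => x _; rewrite hT.
Qed.

Lemma ge0_integral_periods (n : nat) :
  \int[mu]_(x in `[0%R, (n%:R * T)%R[) h x =
  n%:R%:E * \int[mu]_(x in `[0%R, T[) h x.
Proof.
elim: n => [|n IHn].
  by rewrite mul0r mul0e set_itv_ge ?integral_set0// bnd_simp ltxx.
rewrite (@ge0_integral_itvco_split 0%R (n%:R * T)%R); last 2 first.
- by rewrite mulr_ge0.
- by rewrite ler_wpM2r// ler_nat.
rewrite IHn -natr1 EFinD ge0_muleDl ?lee_fin// mul1e; congr (_ + _).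
rewrite mulrDl mul1r addrC -[X in `[X, _[]add0r ge0_integral_itvco_shift.
apply: eq_integral => x _; elim: (n) => [|k IHk]; first by rewrite mul0r addr0.
by rewrite -natr1 mulrDl mul1r addrA hT.
Qed.

End periodic_integrals.

Section polar_coordinates.
Local Open Scope ereal_scope.
Context {R : realType}.
Notation mu := (@lebesgue_measure R).
Notation plane := (measurableTypeR R * measurableTypeR R)%type.
Implicit Type f : plane -> \bar R.

(** The rays at angles a and a + pi together fill the window [-pi/2, 3pi/2[ up to a null set;
    periodicity moves it to [0, 2pi[. *)
Lemma ge0_integral_log_polar f :
  measurable_fun setT f -> (forall p, 0 <= f p) ->
  \int[area_measure]_p f p = \int[mu]_(a in `[0%R, (pi *+ 2)%R[) ray_integral f a.
Proof.
move=> mf f0; rewrite ge0_integral_log_polar_half//.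
have mr := measurable_ray_integral mf f0.
have r0 a : 0 <= ray_integral f a by exact: ray_integral_ge0.
have pi0 := pi_gt0 R.
rewrite integral_itv_obnd_cbnd; last first.
  apply: emeasurable_funD; apply: measurable_funTS => //.
  by apply: (measurableT_comp mr); exact: measurable_funD.
rewrite ge0_integralD//; last 2 first.
- exact: measurable_funTS.
- apply: measurable_funTS.
  by apply: (measurableT_comp mr); exact: measurable_funD.
rewrite -ge0_integral_itvco_shift//.
rewrite (_ : - (pi / 2) + pi = pi / 2)%R; last by field.
rewrite -(ge0_integral_itvco_split mr r0); last 2 first.
- by lra.
- by lra.
rewrite (_ : pi / 2 + pi = - (pi / 2) + pi *+ 2)%R; last by field.
rewrite (@ge0_integral_period _ _ mr r0 _ (ray_integralD2pi f) _ 0%R) ?add0r//.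
- by lra.
- by lra.
Qed.

Definition rotate (a : R) (p : plane) : plane :=
  (p.1 * cos a - p.2 * sin a, p.1 * sin a + p.2 * cos a)%R.

Lemma measurable_rotate a : measurable_fun setT (rotate a).
Proof.
by apply: measurable_fun_pair; [apply: measurable_funB|apply: measurable_funD];
  apply: measurable_funM.
Qed.

(** In polar coordinates a rotation shifts the angular window, and the integral of a periodic
    function over one period does not see the shift. *)
Lemma ge0_integral_rotate a f : (0 <= a <= pi *+ 2)%R ->
  measurable_fun setT f -> (forall p, 0 <= f p) ->
  \int[area_measure]_p f (rotate a p) = \int[area_measure]_p f p.
Proof.
move=> /andP[a0 a2pi] mf f0.
have mfr : measurable_fun setT (f \o rotate a).
  exact: measurableT_comp mf (measurable_rotate a).
transitivity (\int[mu]_(b in `[0%R, (pi *+ 2)%R[) ray_integral (f \o rotate a) b).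
  exact: (ge0_integral_log_polar mfr (fun p => f0 (rotate a p))).
have mr := measurable_ray_integral mf f0.
have r0 b : 0 <= ray_integral f b by exact: ray_integral_ge0.
have := @ge0_integral_period _ _ mr r0 _ (ray_integralD2pi f) 0%R a a0.
rewrite add0r => /(_ a2pi) pE.
rewrite (ge0_integral_log_polar mf f0) pE.
transitivity (\int[mu]_(b in `[(0 + a)%R, (pi *+ 2 + a)%R[) ray_integral f b).
  rewrite (ge0_integral_itvco_shift mr r0).
  apply: eq_integral => b _; apply: eq_integral => t _.
  by rewrite /rotate/= cosD sinD; congr (f (_, _) * _); ring.
by rewrite add0r (addrC _ a).
Qed.

Lemma ge0_integral_translate_plane (c : R * R) f :
  measurable_fun setT f -> (forall p, 0 <= f p) ->
  \int[area_measure]_p f (p.1 + c.1, p.2 + c.2)%R = \int[area_measure]_p f p.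
Proof.
move=> mf f0; rewrite !ge0_integral_plane//; last first.
  apply: (measurableT_comp mf); apply: measurable_fun_pair;
    by apply: measurable_funD.
rewrite -(@ge0_integral_translate _ c.1 (fun x => \int[mu]_y f (x, y))); last 2 first.
- exact: (@measurable_fun_fubini_tonelli_F _ _ (measurableTypeR R)
    (measurableTypeR R) R mu _ mf f0).
- by move=> x; exact: integral_ge0.
apply: eq_integral => x _.
rewrite (@ge0_integral_translate _ c.2 (fun y => f (x + c.1, y)%R))//.
exact: measurableT_comp mf (measurable_pair1 _).
Qed.

End polar_coordinates.

(** * Area integrals over the complex plane *)

Section complex_plane.
Local Open Scope complex_scope.
Context {R : realType}.
Notation plane := (measurableTypeR R * measurableTypeR R)%type.
Implicit Type z w : R[i].

Definition complex_of (p : plane) : R[i] := p.1 +i* p.2.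

Definition normc2 z : R := complex.Re z ^+ 2 + complex.Im z ^+ 2.

Lemma normc2_ge0 z : 0 <= normc2 z.
Proof. by rewrite addr_ge0// sqr_ge0. Qed.

Lemma normc2M z w : normc2 (z * w) = normc2 z * normc2 w.
Proof. by case: z => a b; case: w => c d; rewrite /normc2/=; ring. Qed.

Lemma normc21 : normc2 1 = 1.
Proof. by rewrite /normc2/= expr1n expr0n addr0. Qed.

Lemma normc2X z n : normc2 (z ^+ n) = normc2 z ^+ n.
Proof. by elim: n => [|n IHn]; rewrite ?normc21// !exprS normc2M IHn. Qed.

Lemma normc2_norm z : (normc2 z)%:C = `|z| ^+ 2.
Proof. by rewrite -add_Re2_Im2. Qed.

Lemma normc2_eq0 z : (normc2 z == 0) = (z == 0).
Proof.
by rewrite -(inj_eq (@complexI _)) normc2_norm sqrf_eq0 normr_eq0.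
Qed.

Lemma normc2_gt0 z : (0 < normc2 z) = (z != 0).
Proof. by rewrite lt0r normc2_ge0 andbT normc2_eq0. Qed.

Lemma le_normc2 z w : (normc2 z <= normc2 w) = (`|z| <= `|w|).
Proof. by rewrite -lecR !normc2_norm ler_sqr// nnegrE. Qed.

Lemma normc2_real (x : R) : normc2 x%:C = x ^+ 2.
Proof. by rewrite /normc2/= expr0n addr0. Qed.

Lemma normc2_conj z : normc2 z^*%C = normc2 z.
Proof. by case: z => a b; rewrite /normc2/= sqrrN. Qed.

Lemma Re_mul_conj z : complex.Re (z * z^*%C) = normc2 z.
Proof. by case: z => a b; rewrite /normc2/=; ring. Qed.

Definition measurable_complex (F : plane -> R[i]) :=
  measurable_fun setT (fun p => complex.Re (F p)) /\
  measurable_fun setT (fun p => complex.Im (F p)).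

Lemma measurable_complex_of : measurable_complex complex_of.
Proof. by split; [exact: measurable_fst|exact: measurable_snd]. Qed.

Lemma measurable_complex_cst z : measurable_complex (fun=> z).
Proof. by split. Qed.

Lemma measurable_complexD F G : measurable_complex F -> measurable_complex G ->
  measurable_complex (fun p => F p + G p).
Proof.
move=> [F1 F2] [G1 G2]; split.
  rewrite (_ : (fun p => _) = (fun p => complex.Re (F p)) \+ (fun p => complex.Re (G p))).
    exact: measurable_funD.
  by apply/funext => p /=; case: (F p) => a b; case: (G p).
rewrite (_ : (fun p => _) = (fun p => complex.Im (F p)) \+ (fun p => complex.Im (G p))).
  exact: measurable_funD.
by apply/funext => p /=; case: (F p) => a b; case: (G p).
Qed.

Lemma measurable_complexM F G : measurable_complex F -> measurable_complex G ->
  measurable_complex (fun p => F p * G p).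
Proof.
move=> [F1 F2] [G1 G2]; split.
  rewrite (_ : (fun p => _) = (fun p => complex.Re (F p) * complex.Re (G p)
      - complex.Im (F p) * complex.Im (G p))).
    by apply: measurable_funB; apply: measurable_funM.
  by apply/funext => p /=; case: (F p) => a b; case: (G p).
rewrite (_ : (fun p => _) = (fun p => complex.Re (F p) * complex.Im (G p)
    + complex.Im (F p) * complex.Re (G p))).
  by apply: measurable_funD; apply: measurable_funM.
by apply/funext => p /=; case: (F p) => a b; case: (G p).
Qed.

Lemma measurable_complexX F n : measurable_complex F ->
  measurable_complex (fun p => F p ^+ n).
Proof.
move=> mF; elim: n => [|n IHn]; first exact: measurable_complex_cst.
by under eq_fun do rewrite exprS; exact: measurable_complexM.
Qed.

Lemma measurable_complex_conj F : measurable_complex F ->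
  measurable_complex (fun p => (F p)^*%C).
Proof.
move=> [F1 F2]; split.
  rewrite (_ : (fun p => _) = (fun p => complex.Re (F p)))//.
  by apply/funext => p; case: (F p).
rewrite (_ : (fun p => _) = \- (fun p => complex.Im (F p))).
  exact: measurable_funN.
by apply/funext => p /=; case: (F p).
Qed.

Lemma measurable_horner (P : {poly R[i]}) F : measurable_complex F ->
  measurable_complex (fun p => P.[F p]).
Proof.
move=> mF; elim/poly_ind: P => [|P c IHP].
  by under eq_fun do rewrite horner0; exact: measurable_complex_cst.
under eq_fun do rewrite hornerMXaddC.
apply: measurable_complexD; last exact: measurable_complex_cst.
exact: measurable_complexM.
Qed.

Lemma measurable_normc2 F : measurable_complex F ->
  measurable_fun setT (fun p => normc2 (F p)).
Proof. by move=> [F1 F2]; apply: measurable_funD; exact: measurable_funX. Qed.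

Lemma polarX (t a : R) n :
  complex_of (expR t * cos a, expR t * sin a) ^+ n =
  complex_of (expR (n%:R * t) * cos (n%:R * a), expR (n%:R * t) * sin (n%:R * a)).
Proof.
elim: n => [|n IHn].
  by rewrite expr0 /complex_of/= !mul0r expR0 cos0 sin0 mulr1 mulr0.
rewrite exprS IHn /complex_of/= -[n.+1]add1n natrD !mulrDl !mul1r expRD cosD sinD.
by congr (_ +i* _); ring.
Qed.

Lemma normc2_polar (t a : R) :
  normc2 (complex_of (expR t * cos a, expR t * sin a)) = expR t ^+ 2.
Proof. by rewrite /normc2/= !exprMn -mulrDr cos2Dsin2 mulr1. Qed.

End complex_plane.

Lemma muleIr_EFin {R : realType} (c : R) (x y : \bar R) : 0 < c ->
  (x * c%:E = y * c%:E)%E -> x = y.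
Proof.
by move=> c0 /eqP; rewrite eq_le !lee_pmul2r ?lte_fin// -eq_le => /eqP.
Qed.

Lemma integral_itv_exprn {R : realType} (r : R) (n : nat) : 0 < r ->
  (\int[lebesgue_measure]_(x in `[0%R, r]) (x ^+ n)%:E = (r ^+ n.+1 / n.+1%:R)%:E)%E.
Proof.
move=> r0; pose F (x : R) : R := n.+1%:R^-1 * x ^+ n.+1.
have dF (x : R) : is_derive x 1 F (x ^+ n).
  have -> : F = n.+1%:R^-1 \*: ((id : R -> R) ^+ n.+1).
    by apply/funext => y; rewrite /F /= exprfctE.
  apply: is_derive_eq.
  by rewrite /GRing.scale/= mulr1 mulrA mulVf ?mul1r// pnatr_eq0.
have cF x : {for x, continuous F} by exact/differentiable_continuous/derivable1_diffP.
rewrite (@continuous_FTC2 _ _ F)//.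
- by rewrite /F expr0n mulr0 sube0 mulrC.
- by apply: continuous_in_subspaceT => x _; exact: exprn_continuous.
- split => //.
  + by apply: cvg_at_right_filter; apply: cF.
  + by apply: cvg_at_left_filter; apply: cF.
- by move=> x _; rewrite derive1E derive_val.
Qed.

Section complex_integrals.
Local Open Scope ereal_scope.
Local Open Scope complex_scope.
Context {R : realType}.
Notation mu := (@lebesgue_measure R).
Notation plane := (measurableTypeR R * measurableTypeR R)%type.

Variable F : R[i] -> \bar R.
Hypotheses (mF : measurable_fun setT (fun p : plane => F (complex_of p)))
  (F0 : forall z, 0 <= F z).

Lemma measurable_comp_complex (H : plane -> R[i]) : measurable_complex H ->
  measurable_fun setT (fun p => F (H p)).
Proof.
move=> [H1 H2].
rewrite (_ : (fun p => _) = (fun p => F (complex_of p)) \o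
    (fun p => (complex.Re (H p), complex.Im (H p)) : plane)).
  by apply: (measurableT_comp mF); exact: measurable_fun_pair.
by apply/funext => p /=; rewrite /complex_of/=; case: (H p).
Qed.

Lemma ge0_integral_complexD (c : R[i]) :
  \int[area_measure]_p F (complex_of p + c)%R = \int[area_measure]_p F (complex_of p).
Proof.
case: c => a b.
exact: (@ge0_integral_translate_plane _ (a, b) (fun p => F (complex_of p)) mF
  (fun p => F0 _)).
Qed.

Lemma ge0_integral_complex_rotate (a : R) : (0 <= a <= pi *+ 2)%R ->
  \int[area_measure]_p F ((cos a +i* sin a) * complex_of p)%R =
  \int[area_measure]_p F (complex_of p).
Proof.
move=> a0.
rewrite -(@ge0_integral_rotate _ a (fun p => F (complex_of p)) a0 mF (fun p => F0 _)).
apply: eq_integral => -[x y] _; congr F; rewrite /rotate/complex_of/=.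
by congr (_ +i* _)%R; ring.
Qed.

(* [|z| ^ (2 ((s + 1) / m - 1))], the Jacobian weight of [w = z ^ m]; since [ln 0]
   is [0], its junk value at [z = 0] is [1]. *)
Definition power_weight (m s : nat) (z : R[i]) : R :=
  expR ((s.+1%:R / m%:R - 1) * ln (normc2 z))%R.

Lemma measurable_power_weight m s :
  measurable_fun setT (fun p : plane => power_weight m s (complex_of p)).
Proof.
apply: (measurableT_comp (@measurable_expR R)); apply: measurable_funM => //.
apply: (measurableT_comp (@measurable_ln R)).
exact: (measurable_normc2 measurable_complex_of).
Qed.

(** In log-polar coordinates the power map is (a, t) |-> (m a, m t). The radial dilation yields the
    factor m; the angular dilation yields 1 / m, which is cancelled by the m periods that m a runs
    through. The weight exponent comes from e^(2(s+1)t) = e^(2u) e^(2((s+1)/m - 1)u) with u = m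
    t. *)
Lemma ge0_integral_complexX (m s : nat) : (0 < m)%N ->
  \int[area_measure]_p (F (complex_of p ^+ m)%R * (normc2 (complex_of p) ^+ s)%:E)
    * m%:R%:E =
  \int[area_measure]_p (F (complex_of p) * (power_weight m s (complex_of p))%:E).
Proof.
move=> m0.
have mR0 : (0 < m%:R :> R)%R by rewrite ltr0n.
pose f (p : plane) := F (complex_of p ^+ m)%R * (normc2 (complex_of p) ^+ s)%:E.
pose g (p : plane) := F (complex_of p) * (power_weight m s (complex_of p))%:E.
have mf : measurable_fun setT f.
  apply: emeasurable_funM.
    apply: measurable_comp_complex.
    exact: (measurable_complexX _ measurable_complex_of).
  by apply/measurable_EFinP/measurable_funX; exact: (measurable_normc2 measurable_complex_of).
have f0 p : 0 <= f p by rewrite mule_ge0// lee_fin exprn_ge0// normc2_ge0.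
have mg : measurable_fun setT g.
  apply: emeasurable_funM; first exact: mF.
  by apply/measurable_EFinP; exact: measurable_power_weight.
have g0 p : 0 <= g p by rewrite mule_ge0// lee_fin expR_ge0.
rewrite -[X in X * _]/(\int[area_measure]_p f p) -[RHS]/(\int[area_measure]_p g p).
rewrite (ge0_integral_log_polar mf f0) (ge0_integral_log_polar mg g0).
have mr := measurable_ray_integral mg g0.
have r0 b : 0 <= ray_integral g b by exact: ray_integral_ge0.
have rayE a : ray_integral f a * m%:R%:E = ray_integral g (m%:R * a)%R.
  rewrite /ray_integral -ge0_integralZr//; last 2 first.
  - exact: (measurable_ray_integrand a mf).
  - by move=> t _; exact: ray_integrand_ge0.
  rewrite -[RHS](@ge0_integral_affine _ m%:R 0 _ mR0
    (measurable_ray_integrand _ mg)); last by move=> t; exact: ray_integrand_ge0.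
  apply: eq_integral => t _; congr (_ * _).
  rewrite /f /g addr0 polarX -!muleA -!EFinM; congr (_ * _%:E).
  rewrite /power_weight !normc2_polar -[in ln _]expRM_natr expRK.
  rewrite -!expRM_natr -!expRD; congr expR; rewrite -natr1.
  by field; rewrite gt_eqF.
rewrite -ge0_integralZr//; last 2 first.
- exact: measurable_funTS (measurable_ray_integral mf f0).
- by move=> a _; exact: ray_integral_ge0.
under eq_integral do rewrite rayE.
pose k := (ray_integral g) \_ `[0%R, (m%:R * (pi *+ 2))%R[.
have mk : measurable_fun setT k.
  by apply/(measurable_restrictT _ (measurable_itv _)); exact: measurable_funTS.
have k0 a : 0 <= k a by rewrite /k patchE; case: ifPn.
pose km (x : R) := k (m%:R * x + 0)%R.
have mkm : measurable_fun setT km.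
  by apply: (measurableT_comp mk); apply: measurable_funD => //; apply: measurable_funM.
have km0 x : setT x -> 0 <= km x by move=> _; exact: k0.
have mR0' : 0 <= m%:R%:E :> \bar R by rewrite lee_fin ltW.
have twopi0 : (0 <= pi *+ 2 :> R)%R by rewrite mulrn_wge0// pi_ge0.
have E1 : \int[mu]_x km x =
    \int[mu]_(a in `[0%R, (pi *+ 2)%R[) ray_integral g (m%:R * a)%R.
  rewrite [RHS]integral_mkcond; apply: eq_integral => x _.
  rewrite /km /k addr0 !patchE; congr (if _ then _ else _).
  by apply/idP/idP; rewrite !inE/= !in_itv/= pmulr_rge0// ltr_pM2l.
have E2 : \int[mu]_x (km x * m%:R%:E) = \int[mu]_x k x.
  exact: (ge0_integral_affine 0 mR0 mk k0).
have E3 : \int[mu]_x (km x * m%:R%:E) = \int[mu]_x km x * m%:R%:E.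
  exact: (ge0_integralZr mu measurableT mkm km0 mR0').
have E4 : \int[mu]_x k x =
    m%:R%:E * \int[mu]_(a in `[0%R, (pi *+ 2)%R[) ray_integral g a.
  rewrite -(ge0_integral_periods mr r0 twopi0 (ray_integralD2pi g)).
  by rewrite [RHS]integral_mkcond.
have E : \int[mu]_(a in `[0%R, (pi *+ 2)%R[) ray_integral g (m%:R * a)%R * m%:R%:E =
    \int[mu]_(a in `[0%R, (pi *+ 2)%R[) ray_integral g a * m%:R%:E.
  apply: (etrans (congr1 (fun x => x * m%:R%:E) (esym E1))).
  apply: (etrans (esym E3)); apply: (etrans E2); apply: (etrans E4).
  exact: muleC.
exact: (muleIr_EFin mR0 E).
Qed.

Lemma ge0_integral_radial (k : nat) (eta : R) : (0 < eta)%R ->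
  \int[area_measure]_p (if (normc2 (complex_of p : R[i]) < eta)%R
     then normc2 (complex_of p) ^+ k else 0%R)%:E =
  (pi * eta ^+ k.+1 / k.+1%:R)%:E.
Proof.
move=> eta0.
pose g (x : R) : R := if (x ^+ 2 < eta)%R then (x ^+ k.*2)%R else 0%R.
have mg : measurable_fun setT g.
  apply: measurable_fun_ifT.
  - by apply: measurable_fun_ltr.
  - exact: exprn_measurable.
  - exact: measurable_cst.
pose f (p : plane) := (if (normc2 (complex_of p : R[i]) < eta)%R
  then normc2 (complex_of p) ^+ k else 0%R)%:E.
have mn : measurable_fun setT (fun p : plane => normc2 (complex_of p : R[i])).
  exact: (measurable_normc2 measurable_complex_of).
have mf : measurable_fun setT f.
  apply/measurable_EFinP; apply: measurable_fun_ifT.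
  - by apply: measurable_fun_ltr.
  - exact: (measurable_funX _ mn).
  - exact: measurable_cst.
have f0 p : 0 <= f p.
  by rewrite lee_fin; case: ifP => // _; rewrite exprn_ge0// normc2_ge0.
rewrite -[LHS]/(\int[area_measure]_p f p) (ge0_integral_log_polar mf f0).
have rayE a : ray_integral f a = (eta ^+ k.+1 / (k.+1%:R * 2))%:E.
  transitivity (\int[mu]_t ((g (expR t) * `|expR t|)%:E * (expR t)%:E)).
    apply: eq_integral => t _; rewrite /f normc2_polar -!EFinM; congr EFin.
    by rewrite ger0_norm ?expR_ge0// -mulrA -expr2 /g; case: ifP => // _; rewrite -exprM mul2n.
  have mgn : measurable_fun setT (fun x : R => (g x * `|x|)%:E).
    apply/measurable_EFinP/measurable_funM => //; exact: normr_measurable.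
  have gn0 x : 0 <= (g x * `|x|)%:E.
    by rewrite lee_fin mulr_ge0// /g; case: ifP => // _; rewrite -mul2n exprM exprn_ge0// sqr_ge0.
  rewrite -(ge0_integral_exp mgn gn0).
  pose rt := Num.sqrt eta.
  have rt0 : (0 < rt)%R by rewrite sqrtr_gt0.
  have rt2 : (rt ^+ 2 = eta)%R by rewrite sqr_sqrtr// ltW.
  transitivity (\int[mu]_(x in `]0%R, rt[) (x ^+ k.*2.+1)%:E).
    rewrite integral_mkcond [RHS]integral_mkcond; apply: eq_integral => x _.
    rewrite !patchE; case: ifPn => [|/negP nx]; last first.
      rewrite memNset//= in_itv/= => /andP[x0 _].
      by apply: nx; rewrite inE/= in_itv/= x0.
    rewrite inE/= in_itv/= andbT => x0.
    rewrite /g ger0_norm ?ltW//.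
    have -> : (x ^+ 2 < eta)%R = (x < rt)%R.
      by rewrite -rt2 ltr_pXn2r// nnegrE ltW.
    case: ltP => xrt; first by rewrite mem_set /= ?in_itv/= ?x0// -exprSr.
    rewrite memNset ?mul0r//= in_itv/= => /andP[_].
    by rewrite ltNge xrt.
  rewrite -(@integral_itv_bndoo _ _ _ _ true false); last first.
    by apply/measurable_EFinP; apply: measurable_funTS; exact: measurable_funX.
  rewrite integral_itv_exprn//; congr EFin.
  rewrite -rt2 -exprM mul2n doubleS; congr (_ / _)%R.
  by rewrite -doubleS -muln2 natrM.
under eq_integral do rewrite rayE.
rewrite integral_cst//= lebesgue_measure_itv/= lte_fin mulrn_wgt0 ?pi_gt0//.
rewrite -EFinB -EFinM; congr EFin.
rewrite subr0 -mulr_natr; field.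
by rewrite nat1r pnatr_eq0.
Qed.

End complex_integrals.

(** * Polynomial approximation of powers of [1 + x] *)

Section binomial_approximation.
Variable K : numFieldType.
Implicit Types (P Q D : {poly K}) (x r t : K).

(** The generalised binomial coefficient b(b - 1)...(b - j + 1) / j!, so that [binomial_poly b N]
    truncates the series of (1 + X)^b. *)
Fixpoint binomial_coef (b : K) (j : nat) : K :=
  if j is i.+1 then binomial_coef b i * (b - i%:R) / i.+1%:R else 1.

Definition binomial_poly (b : K) (N : nat) : {poly K} :=
  \poly_(j < N.+1) binomial_coef b j.

Lemma norm_binomial_coef (b : K) j : `|b| <= 1 -> `|binomial_coef b j| <= 1.
Proof.
move=> b1; elim: j => [|j IHj] /=; first by rewrite normr1.
rewrite -mulrA normrM mulr_ile1// normrM normfV normr_nat ler_pdivrMr ?ltr0n// mul1r.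
by rewrite (le_trans (ler_normB _ _))// normr_nat -natr1 addrC lerD2l.
Qed.

Lemma binomial_poly0 (b : K) N : (binomial_poly b N).[0] = 1.
Proof. by rewrite horner_coef0 coef_poly. Qed.

(** The equation (1 + X) B' = b B characterises (1 + X)^b; truncation leaves one error term, in the
    degree where the recursion is cut. *)
Lemma binomial_poly_ode (b : K) N :
  (1 + 'X) * (binomial_poly b N)^`() =
  b *: binomial_poly b N - ((b - N%:R) * binomial_coef b N) *: 'X^N.
Proof.
apply/polyP => j; rewrite mulrDl mul1r coefD coefXM coefB !coefZ coefXn.
have -> : (if j == 0%N then 0 else (binomial_poly b N)^`()`_j.-1) =
    (if (j < N.+1)%N then binomial_coef b j else 0) *+ j.
  by case: j => [|j]; rewrite ?mulr0n//= coef_deriv coef_poly.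
rewrite coef_deriv !coef_poly !ltnS; have [jN|Nj|->] := ltngtP j N.
- rewrite /= mulr0 subr0 -[X in X + _]mulr_natr divfK ?pnatr_eq0// -mulr_natr.
  by ring.
- by rewrite mul0rn mul0rn mulr0 mulr0 subr0 addr0.
- by rewrite mul0rn add0r -mulr_natr /= mulr1; ring.
Qed.

(* The ODE (1+X) D' = q D determines every coefficient of D from the constant
   one, so a solution modulo X^N with D(0) = 0 vanishes modulo X^(N+1). *)
Lemma ode_coef_eq0 (q : K) N D W :
  (1 + 'X) * D^`() = q *: D + 'X^N * W -> D`_0 = 0 ->
  forall i, (i <= N)%N -> D`_i = 0.
Proof.
move=> ode D0; elim=> [//|i IHi] iN.
have /(congr1 (fun p : {poly K} => p`_i)) := ode.
rewrite mulrDl mul1r coefD coefXM coefD coefZ coefXnM iN addr0.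
rewrite IHi 1?ltnW// mulr0 coef_deriv.
have -> : (if i == 0%N then 0 else D^`()`_i.-1) = 0.
  case: i IHi iN => [//|i] IHi iN /=.
  by rewrite coef_deriv IHi ?mul0rn// ltnW.
by rewrite addr0 => /eqP; rewrite mulrn_eq0 => /eqP.
Qed.

(** Majorants in the sense of Cauchy: coefficient bounds pass to products and control values on
    disks. *)
Definition dominated P Q := forall i, `|P`_i| <= Q`_i.

Lemma dominatedM P P' Q Q' :
  dominated P Q -> dominated P' Q' -> dominated (P * P') (Q * Q').
Proof.
move=> PQ PQ' i; rewrite !coefM (le_trans (ler_norm_sum _ _ _))//.
by apply: ler_sum => j _; rewrite normrM ler_pM.
Qed.

Lemma dominatedX P Q n : dominated P Q -> dominated (P ^+ n) (Q ^+ n).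
Proof.
move=> PQ; elim: n => [|n IHn]; last by rewrite !exprS; exact: dominatedM.
by move=> i; rewrite !expr0 coef1; case: (i == 0%N); rewrite ?normr1 ?normr0.
Qed.

Lemma dominatedB P P' Q Q' :
  dominated P Q -> dominated P' Q' -> dominated (P - P') (Q + Q').
Proof.
move=> PQ PQ' i; rewrite coefB coefD (le_trans (ler_normB _ _))//.
exact: lerD.
Qed.

Lemma dominated_1X : dominated (1 + 'X) (1 + 'X).
Proof.
move=> i; rewrite coefD coef1 coefX ger0_norm// addr_ge0//.
Qed.

(** A gain as in the Schwarz lemma: every surviving monomial has degree above [N], so going from
    radius [t] down to [r] gains (r / t)^(N+1) on each. *)
Lemma dominated_horner P Q N r t x : dominated P Q ->
  (forall i, (i <= N)%N -> P`_i = 0) -> `|x| <= r -> r <= t -> 0 < t ->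
  `|P.[x]| <= (r / t) ^+ N.+1 * Q.[t].
Proof.
move=> PQ P0 xr rt t0; pose n := maxn (size P) (size Q).
have r0 : 0 <= r := le_trans (normr_ge0 _) xr.
have rt0 : 0 <= r / t by rewrite divr_ge0// ltW.
have rt1 : r / t <= 1 by rewrite ler_pdivrMr// mul1r.
rewrite (@horner_coef_wide _ n P) ?leq_maxl// (@horner_coef_wide _ n Q) ?leq_maxr//.
rewrite (le_trans (ler_norm_sum _ _ _))// mulr_sumr; apply: ler_sum => i _.
have Q0 : 0 <= Q`_i := le_trans (normr_ge0 _) (PQ i).
have [iN|Ni] := leqP i N.
  by rewrite P0// mul0r normr0 mulr_ge0 ?exprn_ge0// mulr_ge0// exprn_ge0// ltW.
rewrite normrM normrX mulrCA ler_pM// ?exprn_ge0//.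
rewrite (le_trans (lerXn2r _ _ _ xr)) ?nnegrE//.
have -> : r ^+ i = (r / t) ^+ i * t ^+ i by rewrite -exprMn divfK// gt_eqF.
apply: ler_wpM2r; first by rewrite exprn_ge0 ?ltW.
rewrite -(subnKC Ni) exprD.
by rewrite ler_piMr ?exprn_ge0// exprn_ile1.
Qed.

(** Because m b + c = e, both B^m (1 + X)^c and (1 + X)^e satisfy (1 + X) Y' = e Y modulo X^N, with
    the same value at 0. They therefore agree through degree [N], and the majorants bound what
    remains: 1 / (1 - t) comes from the geometric series, the powers of 2 from 1 + t <= 2. *)
Lemma binomial_poly_approx (b : K) (m c e N : nat) r t x :
  `|b| <= 1 -> m%:R * b + c%:R = e%:R ->
  `|x| <= r -> r <= t -> 0 < t -> t < 1 ->
  `|(binomial_poly b N).[x] ^+ m * (1 + x) ^+ c - (1 + x) ^+ e| <=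
  (r / t) ^+ N.+1 * ((1 - t)^-1 ^+ m * 2 ^+ c + 2 ^+ e).
Proof.
move=> b1 mbce xr rt t0 t1.
set B := binomial_poly b N.
pose Y : {poly K} := B ^+ m * (1 + 'X) ^+ c; pose Z : {poly K} := (1 + 'X) ^+ e.
have d1X n : (1 + 'X) * ((1 + 'X : {poly K}) ^+ n)^`() = n%:R *: (1 + 'X) ^+ n.
  rewrite deriv_exp derivD derivC derivX add0r mul1r.
  case: n => [|n]; first by rewrite mulr0n mulr0 scale0r.
  by rewrite mulrnAr -exprS scaler_nat.
have Y0 : (Y - Z)`_0 = 0.
  rewrite -horner_coef0 /Y /Z !hornerE binomial_poly0.
  by rewrite !expr1n mulr1 subrr.
have dBm : (1 + 'X) * (B ^+ m)^`() = (m%:R * b) *: B ^+ m -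
    'X^N * ((m%:R * ((b - N%:R) * binomial_coef b N)) *: B ^+ m.-1).
  rewrite deriv_exp; case: (m) => [|k].
    by rewrite !mulr0n mulr0 !mul0r !scale0r mulr0 subrr.
  have := binomial_poly_ode b N; rewrite -/B -!mul_polyC => odeB.
  rewrite /= exprS -mulr_natr !mulrA odeB !polyCM polyC_natr.
  by ring.
pose W : {poly K} := - ((m%:R * ((b - N%:R) * binomial_coef b N)) *: B ^+ m.-1)
  * (1 + 'X) ^+ c.
have ode : (1 + 'X) * (Y - Z)^`() = e%:R *: (Y - Z) + 'X^N * W.
  rewrite derivB mulrBr d1X.
  have -> : (1 + 'X) * Y^`() = ((1 + 'X) * (B ^+ m)^`()) * (1 + 'X) ^+ c +
      B ^+ m * ((1 + 'X) * ((1 + 'X) ^+ c)^`()) by rewrite /Y derivM; ring.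
  rewrite dBm d1X -mbce /W /Y.
  by rewrite -!mul_polyC !polyCD !polyCM /Z; ring.
have dB : dominated B (\poly_(j < N.+1) 1).
  move=> i; rewrite !coef_poly; case: ifP => _; last by rewrite normr0.
  exact: norm_binomial_coef.
have := dominated_horner (dominatedB (dominatedM (dominatedX m dB)
  (dominatedX c dominated_1X)) (dominatedX e dominated_1X))
  (ode_coef_eq0 ode Y0) xr rt t0.
rewrite !hornerE => /le_trans; apply.
have r0 : 0 <= r := le_trans (normr_ge0 _) xr.
apply: ler_wpM2l; first by rewrite exprn_ge0 ?divr_ge0// ltW.
have geo : (\poly_(j < N.+1) (1 : K)).[t] <= (1 - t)^-1.
  rewrite horner_poly; under eq_bigr do rewrite mul1r.
  have t10 : 0 < 1 - t by rewrite subr_gt0.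
  rewrite -[leRHS]mul1r ler_pdivlMr// mulrC -opprB mulNr -subrX1 opprB.
  by rewrite lerBlDr lerDl exprn_ge0// ltW.
have geo0 : 0 <= (\poly_(j < N.+1) (1 : K)).[t].
  by rewrite horner_poly sumr_ge0// => i _; rewrite mul1r exprn_ge0// ltW.
have t12 : 1 + t <= 2 by rewrite (_ : 2 = 1 + 1)// lerD2l ltW.
have t10 : 0 <= 1 + t by rewrite addr_ge0// ltW.
have t20 : (0 : K) <= 2 by [].
have geo1 := le_trans geo0 geo.
by apply: lerD; [apply: ler_pM; rewrite ?exprn_ge0//|]; rewrite lerXn2r.
Qed.

End binomial_approximation.

(** * Polynomials approximating the weight and its inverse *)

Section approximants.
Local Open Scope complex_scope.
Context {R : realType}.
Implicit Types (x z v : R[i]) (r d : R).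

Lemma exprn_small (q A e : R) : 0 <= q -> q < 1 -> 0 < e ->
  exists N, q ^+ N.+1 * A <= e.
Proof.
move=> q0 q1 e0.
have : (fun n => q ^+ n * A) @ \oo --> 0 * A.
  by apply: cvgMl; apply: cvg_expr; rewrite ger0_norm.
rewrite mul0r => /cvgrPdist_le/(_ _ e0) [N _ /(_ N.+1 (leqnSn N))].
rewrite sub0r normrN => H; exists N; exact: le_trans (ler_norm _) H.
Qed.

Lemma norm_sqrt_normc2 z : `|z| = (Num.sqrt (normc2 z))%:C.
Proof. exact: normc_def. Qed.

Lemma le_norm_real z r : 0 <= r -> (`|z| <= r%:C) = (normc2 z <= r ^+ 2).
Proof.
by move=> r0; rewrite norm_sqrt_normc2 lecR -ler_sqr ?nnegrE ?sqrtr_ge0// sqr_sqrtr// normc2_ge0.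
Qed.

Lemma norm_add1_ge z r : `|z| <= r%:C -> (1 - r)%:C <= `|1 + z|.
Proof.
move=> zr; have := lerB_dist 1 (- z); rewrite normr1 normrN opprK.
by apply: le_trans; rewrite rmorphB rmorph1 lerD2l lerN2.
Qed.

(** [T] imitates (1 + x)^((e - c) / m). The choice c = m - s - 1, e = 0 serves the lower bound; c =
    0, e = m - s - 1 serves the upper bound. *)
Lemma binomial_approximant (m c e : nat) r d : (0 < m)%N ->
  (c <= m)%N -> (e <= m)%N -> 0 <= r -> r < 1 -> 0 < d ->
  exists2 T : {poly R[i]}, T.[0] = 1 & forall x, normc2 x <= r ^+ 2 ->
    normc2 T.[x] ^+ m * normc2 (1 + x) ^+ c <=
    (1 + d) ^+ 2 * normc2 (1 + x) ^+ e.
Proof.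
move=> m0 cm em r0 r1 d0.
(* A radius strictly between [r] and 1: the powers of r / t tend to 0 while 1 / (1 - t) stays
   finite. *)
pose t := (1 + r) / 2.
have rt : r <= t by rewrite /t; lra.
have t0 : 0 < t by rewrite /t; lra.
have t1 : t < 1 by rewrite /t; lra.
have rt1 : r < t by rewrite /t; lra.
move: t rt t0 t1 rt1 => t rt t0 t1 rt1.
have r10 : 0 < 1 - r by rewrite subr_gt0.
pose b : R[i] := (e%:R - c%:R) / m%:R.
have mR : (m%:R : R[i]) != 0 by rewrite pnatr_eq0 -lt0n.
have b1 : `|b| <= 1.
  rewrite /b normrM normfV normr_nat ler_pdivrMr ?ltr0n// mul1r.
  have [ce|ec] := leqP c e.
    by rewrite -natrB// normr_nat ler_nat (leq_trans (leq_subr _ _)).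
  by rewrite -normrN opprB -natrB 1?ltnW// normr_nat ler_nat (leq_trans (leq_subr _ _)).
have mbce : m%:R * b + c%:R = e%:R by rewrite /b mulrC divfK// subrK.
(* The allowed error d (1 - r)^e is at most d |1 + x|^e, which turns an absolute error into a
   relative one. *)
have [N HN] := @exprn_small (r / t) ((1 - t)^-1 ^+ m * 2 ^+ c + 2 ^+ e) (d * (1 - r) ^+ e)
  ltac:(by rewrite divr_ge0// ltW) ltac:(by rewrite ltr_pdivrMr// mul1r)
  ltac:(by rewrite mulr_gt0// exprn_gt0).
exists (binomial_poly b N); first exact: binomial_poly0.
move=> x xr.
have xr' : `|x| <= r%:C by rewrite le_norm_real.
have rt' : r%:C <= t%:C by rewrite lecR.
have t0' : 0 < t%:C by rewrite ltcR.
have t1' : t%:C < 1 by rewrite ltcR.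
have := binomial_poly_approx N b1 mbce xr' rt' t0' t1'.
set Y := (binomial_poly b N).[x] ^+ m * (1 + x) ^+ c.
have -> : (r%:C / t%:C) ^+ N.+1 * ((1 - t%:C)^-1 ^+ m * 2 ^+ c + 2 ^+ e) =
    ((r / t) ^+ N.+1 * ((1 - t)^-1 ^+ m * 2 ^+ c + 2 ^+ e))%:C.
  rewrite !(rmorphM, rmorphXn, fmorphV) rmorphD !(rmorphM, rmorphXn, fmorphV).
  by rewrite rmorphB rmorph1 rmorph_nat.
move=> /le_trans /(_ (_ : _ <= (d * (1 - r) ^+ e)%:C)).
rewrite lecR => /(_ HN) YZ.
have r1x := norm_add1_ge xr'.
have : `|Y| <= (1 + d)%:C * `|1 + x| ^+ e.
  rewrite -[Y](subrK ((1 + x) ^+ e)) (le_trans (ler_normD _ _))//.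
  rewrite normrX rmorphD mulrDl mul1r addrC lerD2l (le_trans YZ)//.
  rewrite rmorphM rmorphXn ler_wpM2l ?lecR ?(ltW d0)//.
  by rewrite lerXn2r// nnegrE ?lecR ?(ltW r10).
rewrite norm_sqrt_normc2 [`|1 + x|]norm_sqrt_normc2 -rmorphXn -rmorphM lecR => H.
have := lerXn2r 2 _ _ H.
rewrite !nnegrE sqrtr_ge0 mulr_ge0 ?addr_ge0 ?exprn_ge0 ?sqrtr_ge0 ?(ltW d0)// => /(_ isT isT).
rewrite sqr_sqrtr ?normc2_ge0// exprMn -exprM mulnC exprM sqr_sqrtr ?normc2_ge0//.
by rewrite /Y normc2M !normc2X.
Qed.

Lemma power_weight_gt0 (m s : nat) z : 0 < power_weight m s z.
Proof. exact: expR_gt0. Qed.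

(** The exponents cancel: m ((s + 1) / m - 1) + (m - s - 1) = 0. Bounds on the weight are proved
    between [m]-th powers through this identity. *)
Lemma power_weightX (m s : nat) z : (s < m)%N -> z != 0 ->
  power_weight m s z ^+ m * normc2 z ^+ (m - s.+1) = 1.
Proof.
move=> sm z0; have n0 : 0 < normc2 z by rewrite normc2_gt0.
have mR : (m%:R : R) != 0 by rewrite pnatr_eq0 -lt0n (leq_trans _ sm).
rewrite -[X in _ * X ^+ _]lnK// -!expRM_natr -expRD natrB//.
by rewrite -[RHS]expR0; congr expR; field.
Qed.

Lemma add1_neq0 r z : r < 1 -> 0 <= r -> normc2 z <= r ^+ 2 -> 1 + z != 0.
Proof.
move=> r1 r0; apply: contraTneq => /eqP; rewrite addrC addr_eq0 => /eqP ->.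
by rewrite -ltNge -normc2_conj normc2_conj /normc2/= oppr0 expr0n addr0 sqrrN expr1n exprn_ilt1.
Qed.

Lemma lower_approximant (m s : nat) r d : (s < m)%N -> 0 <= r -> r < 1 -> 0 < d ->
  exists2 U : {poly R[i]}, U.[0] = 1 & forall v, normc2 v <= r ^+ 2 ->
    normc2 U.[v] <= (1 + d) ^+ 2 * power_weight m s (1 + v).
Proof.
move=> sm r0 r1 d0; have m0 : (0 < m)%N by exact: leq_ltn_trans sm.
have [U U0 UE] := binomial_approximant m0 (leq_subr s.+1 m) (leq0n m) r0 r1 d0.
exists U => // v vr; have v1 := add1_neq0 r1 r0 vr.
have d1 : 1 <= (1 + d) ^+ 2 by rewrite exprn_ege1// lerDl ltW.
have w0 := power_weight_gt0 m s (1 + v).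
rewrite -(@ler_pXn2r _ m)// ?nnegrE ?normc2_ge0//; last first.
  by rewrite mulr_ge0 ?(ltW w0)// (le_trans _ d1).
have n0 : 0 < normc2 (1 + v) ^+ (m - s.+1) by rewrite exprn_gt0// normc2_gt0.
rewrite -(ler_pM2r n0) exprMn -mulrA power_weightX// mulr1.
rewrite (le_trans (UE v vr))// expr0 mulr1.
by rewrite -[leLHS]expr1 ler_weXn2l.
Qed.

Lemma upper_approximant (m s : nat) r d : (s < m)%N -> 0 < r -> r < 1 -> 0 < d ->
  exists2 T : {poly R[i]}, T.[0] = 1 & exists2 eta, 0 < eta < r ^+ 2 &
    forall v, eta <= normc2 v -> normc2 v <= r ^+ 2 ->
      normc2 T.[(r ^+ 2)%:C / v] * power_weight m s (1 + v) <= (1 + d) ^+ 4.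
Proof.
move=> sm r0 r1 d0; have m0 : (0 < m)%N by exact: leq_ltn_trans sm.
(* Since |r^2 / v| >= r for |v| <= r, the series must be accurate on a disk larger than the one of
   radius [r]. *)
pose r' := (1 + r) / 2.
have r'0 : 0 <= r' by rewrite /r'; lra.
have r'1 : r' < 1 by rewrite /r'; lra.
have rr' : r < r' by rewrite /r'; lra.
have [T T0 TE] := binomial_approximant m0 (leq0n m) (leq_subr s.+1 m) r'0 r'1 d0.
exists T => //.
(* [q] bounds k = r^2 / |v|^2, where x = r^2 / v = k conj(v). The first term keeps |x|^2 = k r^2
   below r'^2; the second gives (k - 1)|v| <= d (1 - r) <= d |1 + v|, hence |1 + x| <= (1 + d)|1 +
   v|. *)
pose q := Num.min (r' / r) (1 + d * (1 - r)).
have q1 : 1 < q.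
  by rewrite lt_min ltr_pdivlMr// mul1r rr' ltrDl mulr_gt0// subr_gt0.
have q0 : 0 < q by rewrite (lt_trans _ q1).
exists (r ^+ 2 / q).
  by rewrite divr_gt0 ?exprn_gt0//= ltr_pdivrMr// ltr_pMr// exprn_gt0.
move=> v; rewrite ler_pdivrMr// => ev vr.
have v0 : v != 0.
  rewrite -normc2_gt0 -(pmulr_lgt0 _ q0); apply: lt_le_trans ev.
  by rewrite exprn_gt0.
have n0 : 0 < normc2 v by rewrite normc2_gt0.
pose k := r ^+ 2 / normc2 v.
have k1 : 1 <= k by rewrite ler_pdivlMr// mul1r.
have kq : k <= q by rewrite ler_pdivrMr// mulrC.
have xE : (r ^+ 2)%:C / v = k%:C * v^*%C.
  have -> : k%:C = (r ^+ 2)%:C / (v * v^*%C).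
    rewrite /k rmorphM fmorphV; congr (_ / _).
    by case: (v) => a b'; rewrite /normc2/=; simpc; congr (_ +i* _); ring.
  by field; rewrite v0 conjc_eq0 v0.
set x := _ / v in xE *.
have nx : normc2 x <= r' ^+ 2.
  rewrite xE normc2M normc2_real normc2_conj expr2 -mulrA -[k * normc2 v]/(_ / _ * _) divfK ?gt_eqF//.
  have kr : k <= r' / r by rewrite (le_trans kq)// /q ge_min lexx.
  rewrite (le_trans (ler_wpM2r _ kr)) ?sqr_ge0// expr2 mulrA divfK ?gt_eqF//.
  by rewrite expr2 ler_wpM2l// ltW.
have v1 := add1_neq0 r1 (ltW r0) vr.
have vr' : `|v| <= r%:C by rewrite le_norm_real// ltW.
have r1v := norm_add1_ge vr'.
have n1x : normc2 (1 + x) <= (1 + d) ^+ 2 * normc2 (1 + v).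
  rewrite -normc2_real -normc2M le_normc2 normrM.
  have -> : 1 + x = (1 + v)^*%C + ((k - 1)%:C * v^*%C).
    by rewrite xE rmorphD rmorph1 rmorphB rmorph1; ring.
  rewrite (le_trans (ler_normD _ _))// normrM !norm_conjC.
  have d10 : 0 <= (1 + d)%:C by rewrite ler0c addr_ge0// ltW.
  have k10 : 0 <= (k - 1)%:C by rewrite ler0c subr_ge0.
  rewrite (ger0_norm d10) (ger0_norm k10).
  have -> : (1 + d)%:C = 1 + d%:C by rewrite rmorphD rmorph1.
  rewrite mulrDl mul1r lerD2l.
  apply: (@le_trans _ _ ((k - 1) * r)%:C).
    by rewrite rmorphM ler_wpM2l// ler0c subr_ge0.
  apply: (@le_trans _ _ (d * (1 - r))%:C); last first.
    by rewrite rmorphM ler_wpM2l// ler0c ltW.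
  rewrite lecR (@le_trans _ _ (k - 1))//.
    by rewrite ler_piMr ?subr_ge0// ltW.
  by rewrite lerBlDl (le_trans kq)// /q ge_min lexx orbT.
have w0 := power_weight_gt0 m s (1 + v).
set p := (m - s.+1)%N in TE *.
have d1 : 1 <= 1 + d by rewrite lerDl ltW.
rewrite -(@ler_pXn2r _ m)// ?nnegrE ?exprn_ge0 ?(le_trans _ d1)//; last first.
  by rewrite mulr_ge0 ?normc2_ge0// ltW.
rewrite exprMn.
have := TE x nx; rewrite expr0 mulr1 => H.
have H2 : normc2 T.[x] ^+ m <= (1 + d) ^+ 2 * ((1 + d) ^+ 2 * normc2 (1 + v)) ^+ p.
  rewrite (le_trans H)// ler_wpM2l ?sqr_ge0// lerXn2r ?nnegrE ?normc2_ge0//.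
  by rewrite mulr_ge0 ?sqr_ge0 ?normc2_ge0.
rewrite (le_trans (ler_wpM2r _ H2)) ?exprn_ge0 ?(ltW w0)//.
have wn := power_weightX sm v1; rewrite -/p in wn.
have -> : (1 + d) ^+ 2 * ((1 + d) ^+ 2 * normc2 (1 + v)) ^+ p *
    power_weight m s (1 + v) ^+ m = (1 + d) ^+ 2 * (1 + d) ^+ 2 ^+ p *
    (power_weight m s (1 + v) ^+ m * normc2 (1 + v) ^+ p).
  by rewrite exprMn; ring.
rewrite wn mulr1.
(* What remains is (1 + d)^(2 + 2p) with p < m, against the [m]-th power of (1 + d)^4. *)
rewrite -exprM -exprD -exprM ler_weXn2l//.
by rewrite -mulnS leq_mul// /p ltn_subrL m0.
Qed.

End approximants.

(** * Averages over roots of unity *)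

Section roots_of_unity.
Local Open Scope complex_scope.
Context {R : realType}.
Implicit Types (v z : R[i]) (P Q U : {poly R[i]}).

Definition unit_root (M : nat) : R[i] :=
  cos (pi *+ 2 / M%:R) +i* sin (pi *+ 2 / M%:R).

Lemma unit_rootX M l : unit_root M ^+ l =
  cos (l%:R * (pi *+ 2 / M%:R)) +i* sin (l%:R * (pi *+ 2 / M%:R)).
Proof.
have := polarX (0 : R) (pi *+ 2 / M%:R) l.
by rewrite /complex_of/= mulr0 expR0 !mul1r.
Qed.

Lemma unit_root_expn M : (0 < M)%N -> unit_root M ^+ M = 1.
Proof.
move=> M0; rewrite unit_rootX mulrC divfK ?pnatr_eq0 -?lt0n//.
by rewrite cos2pi sin2pi.
Qed.

(** Half-angle formula: cos a = 1 - 2 sin^2(a / 2), and the sine is positive because 0 < a / 2 <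
    pi. *)
Lemma unit_root_neq1 M j : (0 < j < M)%N -> unit_root M ^+ j != 1.
Proof.
move=> /andP[j0 jM]; rewrite unit_rootX.
set a := _ * _.
have MR : 0 < (M%:R : R) by rewrite ltr0n (leq_ltn_trans _ jM).
have pi0 := pi_gt0 R.
have a2 : 0 < sin (a / 2).
  apply: sin_gt0_pi; rewrite /a -[pi *+ 2]mulr_natr; apply/andP; split.
    apply: divr_gt0 => //; apply: mulr_gt0; first by rewrite ltr0n.
    by apply: divr_gt0 => //; apply: mulr_gt0.
  have -> : j%:R * (pi * 2 / M%:R) / 2 = (j%:R / M%:R) * pi :> R by field; rewrite gt_eqF.
  by rewrite gtr_pMl// ltr_pdivrMr// mul1r ltr_nat.
apply/eqP => -[ca _]; move: ca.
have -> : a = (a / 2) *+ 2 by rewrite -mulr_natr divfK.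
rewrite cos_mulr2n cos2sin2 => H.
have : sin (a / 2) ^+ 2 = 0 by lra.
by move/eqP; rewrite sqrf_eq0 gt_eqF.
Qed.

Lemma sum_unit_root M j : (0 < M)%N ->
  \sum_(l < M) (unit_root M ^+ j) ^+ l = if (M %| j)%N then M%:R else 0.
Proof.
move=> M0; case: ifPn => Mj.
  have -> : unit_root M ^+ j = 1.
    by rewrite -(divnK Mj) mulnC exprM unit_root_expn// expr1n.
  by under eq_bigr do rewrite expr1n; rewrite sumr_const card_ord.
have w1 : unit_root M ^+ j != 1.
  rewrite (divn_eq j M) exprD mulnC exprM unit_root_expn// expr1n mul1r.
  by rewrite unit_root_neq1// ltn_mod M0 lt0n andbT.
have := subrX1 (unit_root M ^+ j) M.
rewrite -exprM mulnC exprM unit_root_expn// expr1n subrr => /esym/eqP.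
by rewrite mulf_eq0 subr_eq0 (negbTE w1)/= => /eqP.
Qed.

Lemma normc2_unit_root M l : normc2 (unit_root M ^+ l) = 1.
Proof. by rewrite unit_rootX /normc2/= cos2Dsin2. Qed.

Lemma conj_unit_root M : (0 < M)%N -> (unit_root M)^*%C = unit_root M ^+ M.-1.
Proof.
move=> M0; have u1 := normc2_unit_root M 1; rewrite expr1 in u1.
have u0 : unit_root M != 0 by rewrite -normc2_gt0 u1.
apply: (mulfI u0); rewrite -exprS prednK// unit_root_expn//.
move: u1; rewrite /normc2; case: (unit_root M) => a b /= ab.
by simpc; congr (_ +i* _); [rewrite -ab; ring|ring].
Qed.

(** A discrete Fourier coefficient of index [s]. Exponents stay natural numbers: M - s stands for
    -s, and M - 1 for -1, as conjugation inverts a root of unity. The divisibility condition thus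
    reads i = j + s modulo M. *)
Lemma fourier_coef M s Q U v : (0 < M)%N -> (s <= M)%N ->
  \sum_(l < M) unit_root M ^+ ((M - s) * l) *
     (Q.[unit_root M ^+ l * v] * (U.[unit_root M ^+ l * v])^*%C) =
  M%:R * \sum_(i < size Q) \sum_(j < size U | (M %| i + M.-1 * j + (M - s))%N)
     (Q`_i * v ^+ i) * (U`_j * v ^+ j)^*%C.
Proof.
move=> M0 sM; pose u := unit_root M.
transitivity (\sum_(l < M) \sum_(i < size Q) \sum_(j < size U)
    (Q`_i * v ^+ i) * (U`_j * v ^+ j)^*%C * (u ^+ (i + M.-1 * j + (M - s))) ^+ l).
  apply: eq_bigr => l _; rewrite !horner_coef rmorph_sum/= mulr_suml mulr_sumr.
  apply: eq_bigr => i _; rewrite mulr_sumr mulr_sumr; apply: eq_bigr => j _.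
  have cM (a b : R[i]) : (a * b)^*%C = a^*%C * b^*%C by exact: rmorphM.
  have cX (a : R[i]) n : (a ^+ n)^*%C = a^*%C ^+ n by exact: rmorphXn.
  rewrite !exprMn !cM !cX (conj_unit_root M0) -/u -!exprM.
  rewrite [in RHS]mulnDl [in RHS]mulnDl !exprD.
  have -> : (M.-1 * (l * j) = M.-1 * j * l)%N by rewrite -mulnA [(l * j)%N]mulnC.
  by rewrite [(l * i)%N]mulnC; ring.
rewrite exchange_big mulr_sumr; apply: eq_bigr => i _.
rewrite exchange_big mulr_sumr [RHS]big_mkcond; apply: eq_bigr => j _.
rewrite -mulr_sumr sum_unit_root//; case: ifP => _; last by rewrite mulr0.
by rewrite mulrC.
Qed.

Lemma sqr_sum_le (M : nat) (f : nat -> R) :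
  (\sum_(l < M) f l) ^+ 2 <= M%:R * \sum_(l < M) f l ^+ 2.
Proof.
elim: M => [|[|M] IHM]; first by rewrite !big_ord0 expr0n mulr0.
  by rewrite !big_ord_recl !big_ord0 !addr0 mul1r.
rewrite big_ord_recr [X in _ <= _ * X]big_ord_recr/=.
move: (\sum_(l < M.+1) f l) (\sum_(l < M.+1) f l ^+ 2) IHM => S T IHM.
rewrite -[M.+2]addn1 natrD mulrDl mul1r mulrDr sqrrD.
(* Expanded, this square bounds the cross term 2 S f by S^2 / (M + 1) + (M + 1) f^2, which is the
   induction step of Cauchy-Schwarz. *)
have : 0 <= (S - M.+1%:R * f M.+1) ^+ 2 / M.+1%:R by rewrite divr_ge0 ?sqr_ge0 ?ltW.
have : S ^+ 2 / M.+1%:R <= T by rewrite ler_pdivrMr// mulrC.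
have -> : (S - M.+1%:R * f M.+1) ^+ 2 / M.+1%:R =
  S ^+ 2 / M.+1%:R - S * f M.+1 *+ 2 + M.+1%:R * f M.+1 ^+ 2.
  by field; rewrite nat1r gt_eqF.
move: IHM; move: (f M.+1 ^+ 2) (S ^+ 2) (S ^+ 2 / _) (S * f M.+1 *+ 2) (M.+1%:R * T)
  (M.+1%:R * _) => a b c d e g.
by lra.
Qed.

Lemma normc2_sum_le (M : nat) (f : nat -> R[i]) :
  normc2 (\sum_(l < M) f l) <= M%:R * \sum_(l < M) normc2 (f l).
Proof.
have ReS : complex.Re (\sum_(l < M) f l) = \sum_(l < M) complex.Re (f l).
  by apply: (big_morph _ _ (erefl _)) => -[a b] [a' b'].
have ImS : complex.Im (\sum_(l < M) f l) = \sum_(l < M) complex.Im (f l).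
  by apply: (big_morph _ _ (erefl _)) => -[a b] [a' b'].
rewrite /normc2 ReS ImS big_split/= mulrDr.
by apply: lerD; [exact: (sqr_sum_le M (fun l => complex.Re (f l)))
  |exact: (sqr_sum_le M (fun l => complex.Im (f l)))].
Qed.

Lemma normc2_fourier_le M s Q U v : (0 < M)%N -> (s <= M)%N ->
  M%:R * normc2 (\sum_(i < size Q)
    \sum_(j < size U | (M %| i + M.-1 * j + (M - s))%N)
      (Q`_i * v ^+ i) * (U`_j * v ^+ j)^*%C) <=
  \sum_(l < M) normc2 Q.[unit_root M ^+ l * v] * normc2 U.[unit_root M ^+ l * v].
Proof.
move=> M0 sM; have MR : 0 < (M%:R : R) by rewrite ltr0n.
have := normc2_sum_le M (fun l => unit_root M ^+ ((M - s) * l) *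
     (Q.[unit_root M ^+ l * v] * (U.[unit_root M ^+ l * v])^*%C)).
rewrite /= fourier_coef// normc2M.
have -> : normc2 (M%:R : R[i]) = M%:R ^+ 2.
  by rewrite -[X in normc2 X](rmorph_nat (real_complex R)) normc2_real.
rewrite expr2 -mulrA ler_pM2l// => /le_trans; apply.
by apply: ler_sum => l _; rewrite !normc2M normc2_unit_root mul1r normc2_conj.
Qed.

(* Averaging [Q(v) * conj U(v)] against the [k]-th power over the [M]-th roots of
   unity isolates [Q`_k v ^ k * conj U(0)]; Cauchy-Schwarz does the rest. *)
Lemma normc2_top_coef_le (k M : nat) Q U v : (k + size U < M)%N -> size Q = k.+1 -> Q`_k = 1 ->
  U.[0] = 1 ->
  M%:R * normc2 v ^+ k <=
  \sum_(l < M) normc2 Q.[unit_root M ^+ l * v] * normc2 U.[unit_root M ^+ l * v].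
Proof.
move=> kUM sQ Qk U0; have M0 : (0 < M)%N by exact: leq_ltn_trans kUM.
have kM : (k <= M)%N by rewrite (leq_trans (leq_addr _ _) (ltnW kUM)).
have := normc2_fourier_le Q U v M0 kM; congr (_ * _ <= _).
have U00 : U`_0 = 1 by rewrite -horner_coef0.
have sU : (0 < size U)%N.
  rewrite lt0n size_poly_eq0; apply: contra_eq_neq U0 => ->.
  by rewrite horner0 eq_sym oner_neq0.
rewrite sQ -normc2X; congr normc2.
(* The condition says i = j + k modulo [M]. Both sides are below [M], so it is an equality, and i <=
   k leaves only j = 0, i = k. *)
have idx (i : 'I_k.+1) (j : 'I_(size U)) :
    (M %| i + M.-1 * j + (M - k))%N -> j = 0%N :> nat /\ i = k :> nat.
  move=> /dvdnP[q qE].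
  have E : (j + k = i %[mod M])%N.
    have : (q * M + (j + k) = j.+1 * M + i)%N.
      by rewrite -qE -[X in (_ = _ * X + _)%N](prednK M0); move: kM M0; nia.
    by move=> /(congr1 (modn^~ M)); rewrite !modnMDl.
  have jU := ltn_ord j; have ik := ltn_ord i.
  by move: E; rewrite !modn_small//; move: ik; rewrite ltnS; lia.
rewrite (bigD1 ord_max)//= (bigD1 (Ordinal sU))/=; last first.
  by rewrite muln0 addn0 subnKC// dvdnn.
rewrite Qk U00 !mul1r expr0 conjc1 mulr1 big1 ?addr0; last first.
  by move=> j /andP[/(idx ord_max)[j0 _] /eqP[]]; exact: val_inj.
rewrite big1 ?addr0// => i /eqP ik; apply: big1 => j /idx[_ ik'].
by exfalso; apply: ik; exact: val_inj.
Qed.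

(** [q] collects the coefficients of [P] at exponents congruent to [s] modulo [m], so z^s q(z^m) is
    the average of [P] over rotations against a character; Cauchy-Schwarz bounds it by the average
    of |P|^2. *)
Lemma residue_part_le (m s k : nat) P : (s < m)%N -> size P = (k * m + s).+1 ->
  P`_(k * m + s) = 1 ->
  exists q : {poly R[i]}, [/\ size q = k.+1, q`_k = 1 & forall z,
    m%:R * (normc2 z ^+ s * normc2 q.[z ^+ m]) <=
    \sum_(l < m) normc2 P.[unit_root m ^+ l * z]].
Proof.
move=> sm sP Pn; have m0 : (0 < m)%N by exact: leq_ltn_trans sm.
pose q : {poly R[i]} := \poly_(j < k.+1) P`_(j * m + s).
have qk : q`_k = 1 by rewrite coef_poly ltnSn.
exists q; split => //.
  by rewrite size_poly_eq// Pn oner_neq0.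
move=> z.
have := normc2_fourier_le P 1 z m0 (ltnW sm).
under [X in _ <= X -> _]eq_bigr do rewrite hornerC normc21 mulr1.
congr (_ * _ <= _); rewrite -normc2X -normc2M; congr normc2.
have -> : z ^+ s * q.[z ^+ m] = ('X^s * (q \Po 'X^m)).[z].
  by rewrite hornerM hornerXn horner_comp hornerXn.
have -> : 'X^s * (q \Po 'X^m) =
    \poly_(i < size P) (if (m %| i + (m - s))%N then P`_i else 0).
  apply/polyP => i; rewrite coefXnM coef_poly coef_comp_poly_Xn// coef_poly.
  (* For i < s divisibility fails because 0 < i + (m - s) < m, in accordance with the missing low
     coefficients on the other side. *)
  have [si|si] := ltnP i s.
    case: ifP => // _; case: ifPn => // /dvdnP[j jE]; exfalso.
    case: j jE => [|j]; rewrite ?mulSn; lia.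
  have -> : (i + (m - s) = (i - s) + m)%N by lia.
  rewrite dvdn_addl// sP; case: ifPn => [mi|]; last by case: ifP.
  have iE : ((i - s) %/ m * m + s = i)%N by rewrite divnK// subnK.
  rewrite iE; congr (if _ then _ else _).
  by rewrite -[in RHS]iE !ltnS leq_add2r leq_pmul2r.
rewrite horner_poly; apply: eq_bigr => i _.
rewrite size_poly1 big_mkcond big_ord1 muln0 addn0.
have -> : (1 : {poly R[i]})`_(ord0 : 'I_1) * z ^+ (ord0 : 'I_1) = 1.
  by rewrite coef1 mulr1.
rewrite conjc1 mulr1.
by case: ifP => //; rewrite mul0r.
Qed.

End roots_of_unity.

Lemma ge0_integral_unit_root {R : realType} (F : R[i] -> \bar R) (M l : nat) :
  measurable_fun setT (fun p : measurableTypeR R * measurableTypeR R =>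
    F (complex_of p)) ->
  (forall z, (0 <= F z)%E) -> (l < M)%N ->
  (\int[area_measure]_p F (unit_root M ^+ l * complex_of p)%R =
   \int[area_measure]_p F (complex_of p))%E.
Proof.
move=> mF F0 lM; rewrite unit_rootX; apply: ge0_integral_complex_rotate => //.
have pi20 : 0 <= pi *+ 2 :> R by rewrite mulrn_wge0// pi_ge0.
apply/andP; split; first by rewrite mulr_ge0 ?divr_ge0.
rewrite mulrCA ler_piMr// ler_pdivrMr ?mul1r ?ler_nat ?(ltnW lM)//.
by rewrite ltr0n (leq_ltn_trans _ lM).
Qed.

(** * Minimal norms of monic polynomials *)

Section weighted_disk.
Local Open Scope complex_scope.
Context {R : realType}.
Notation plane := (measurableTypeR R * measurableTypeR R)%type.
Variables (m s : nat) (rho : R).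
Hypotheses (sm : (s < m)%N) (rho0 : 0 < rho) (rho1 : rho < 1).
Implicit Types (v z : R[i]) (P Q U : {poly R[i]}).

(** Extension by 0 instead of a domain of integration, since the rotation and substitution formulas
    are stated over the whole plane. *)
Definition on_disk (f : R[i] -> R) (v : R[i]) : R :=
  if normc2 v < rho ^+ 2 then f v else 0.

Definition weighted_norm2 Q : \bar R :=
  (\int[area_measure]_p
    (on_disk (fun v => normc2 Q.[v] * power_weight m s (1 + v)) (complex_of p))%:E)%E.

Lemma measurable_on_disk (f : R[i] -> R) :
  measurable_fun setT (fun p : plane => f (complex_of p)) ->
  measurable_fun setT (fun p : plane => (on_disk f (complex_of p))%:E).
Proof.
move=> mf; apply/measurable_EFinP; apply: measurable_fun_ifT.
- by apply: measurable_fun_ltr => //; exact: (measurable_normc2 measurable_complex_of).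
- exact: mf.
- exact: measurable_cst.
Qed.

Lemma on_disk_ge0 (f : R[i] -> R) v : (forall v, 0 <= f v) -> 0 <= on_disk f v.
Proof. by move=> f0; rewrite /on_disk; case: ifP. Qed.

Lemma measurable_normc2_horner Q :
  measurable_fun setT (fun p : plane => normc2 Q.[complex_of p]).
Proof. exact: (measurable_normc2 (measurable_horner Q measurable_complex_of)). Qed.

Let wt (v : R[i]) : R := power_weight m s (1 + v).

Lemma measurable_shifted_weight :
  measurable_fun setT (fun p : plane => wt (complex_of p)).
Proof.
apply: (measurableT_comp (@measurable_expR R)); apply: measurable_funM => //.
apply: (measurableT_comp (@measurable_ln R)).
apply: measurable_normc2; apply: measurable_complexD.
  exact: measurable_complex_cst.
exact: measurable_complex_of.
Qed.

Lemma weighted_norm2_ge (k : nat) Q : size Q = k.+1 -> Q`_k = 1 ->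
  ((pi * (rho ^+ 2) ^+ k.+1 / k.+1%:R)%:E <= weighted_norm2 Q)%E.
Proof.
move=> sQ Qk.
set A := pi * _ / _.
have rho20 : 0 < rho ^+ 2 by rewrite exprn_gt0.
pose g v := normc2 Q.[v] * wt v.
have mg : measurable_fun setT (fun p : plane => g (complex_of p)).
  by apply: measurable_funM; [exact: measurable_normc2_horner|exact: measurable_shifted_weight].
have g0 v : 0 <= g v by rewrite mulr_ge0 ?normc2_ge0// ltW ?power_weight_gt0.
suff H d : 0 < d -> (A%:E <= ((1 + d) ^+ 2)%:E * weighted_norm2 Q)%E.
  have I0 : (0 <= weighted_norm2 Q)%E.
    by apply: integral_ge0 => p _; rewrite lee_fin on_disk_ge0.
  move: H I0; case: (weighted_norm2 Q) => [x||] H I0//; last by rewrite leey.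
  rewrite lee_fin; rewrite lee_fin in I0.
  apply/ler_addgt0Pr => e e0.
  (* For d <= 1, (1 + d)^2 x <= x + 3 d x, and 3 d x <= e; the added 3 keeps the denominator
     positive when x = 0. *)
  pose d := Num.min 1 (e / (3 * x + 3)).
  have x3 : 0 < 3 * x + 3 by lra.
  have d0 : 0 < d by rewrite lt_min ltr01 divr_gt0.
  have := H d d0; rewrite -EFinM lee_fin => /le_trans; apply.
  have d1 : d <= 1 by rewrite ge_min lexx.
  have de : d * (3 * x + 3) <= e by rewrite -ler_pdivlMr// ge_min lexx orbT.
  have dx : 0 <= d * x by rewrite mulr_ge0// ltW.
  rewrite (_ : (1 + d) ^+ 2 * x = x + 2 * (d * x) + d * (d * x)); last by ring.
  have ddx : d * (d * x) <= d * x by rewrite ler_piMl.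
  by lra.
move=> d0.
have [U U0 UE] := lower_approximant sm (ltW rho0) rho1 d0.
pose M := (k + size U).+1.
pose f v := normc2 Q.[v] * normc2 U.[v].
have f0 v : 0 <= f v by rewrite mulr_ge0 ?normc2_ge0.
have mf : measurable_fun setT (fun p : plane => f (complex_of p)).
  by apply: measurable_funM; exact: measurable_normc2_horner.
pose F v := (on_disk f v)%:E.
have mF : measurable_fun setT (fun p : plane => F (complex_of p)).
  exact: measurable_on_disk.
have F0 v : (0 <= F v)%E by rewrite lee_fin on_disk_ge0.
apply: (@le_trans _ _ (\int[area_measure]_p F (complex_of p))%E); last first.
  rewrite -ge0_integralZl//; last 3 first.
  - exact: measurable_on_disk.
  - by move=> p _; rewrite lee_fin on_disk_ge0.
  - by rewrite lee_fin sqr_ge0.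
  apply: ge0_le_integral => //.
  - by apply: measurable_funeM; exact: measurable_on_disk.
  move=> p _; rewrite /F -EFinM lee_fin /on_disk; case: ifPn => [vr|]; last by rewrite mulr0.
  by rewrite /f mulrCA ler_wpM2l ?normc2_ge0// UE// ltW.
have M0 : 0 < (M%:R : R) by rewrite ltr0n.
have mFr l : measurable_fun setT (fun p : plane => F (unit_root M ^+ l * complex_of p)%R).
  apply: (measurable_comp_complex mF); apply: measurable_complexM.
    exact: measurable_complex_cst.
  exact: measurable_complex_of.
rewrite -(lee_pmul2l (x := M%:R%:E))// ?lte_fin//.
(* Area and disk are invariant under rotation, so the average over roots of unity can be taken under
   the integral sign, where the pointwise bound applies. *)
have -> : (M%:R%:E * \int[area_measure]_p F (complex_of p) =
    \int[area_measure]_p \sum_(l < M) F (unit_root M ^+ l * complex_of p)%R)%E.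
  rewrite ge0_integral_sum//.
  rewrite (eq_bigr (fun=> (\int[area_measure]_p F (complex_of p))%E)); last first.
    by move=> l _; exact: ge0_integral_unit_root.
  by rewrite sumr_const card_ord mule_natl.
rewrite /A -(ge0_integral_radial k rho20).
have mnk : measurable_fun setT (fun p : plane => (on_disk (fun v => normc2 v ^+ k) (complex_of p))%:E).
  apply: measurable_on_disk.
  exact: (measurable_funX _ (measurable_normc2 measurable_complex_of)).
rewrite -ge0_integralZl//; last first.
  by move=> p _; rewrite lee_fin; case: ifP => // _; rewrite exprn_ge0// normc2_ge0.
apply: ge0_le_integral => //.
- by move=> p _; rewrite mule_ge0 ?lee_fin ?(ltW M0)//; case: ifP => // _; rewrite exprn_ge0// normc2_ge0.
- exact: (measurable_funeM _ mnk).
- exact: emeasurable_sum.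
move=> p _; rewrite -EFinM; set v := complex_of p.
have nl l : normc2 (unit_root M ^+ l * v) = normc2 v.
  by rewrite normc2M normc2_unit_root mul1r.
rewrite /F sumEFin lee_fin /on_disk; under eq_bigr do rewrite nl.
case: ifPn => _; last by rewrite mulr0 sumr_ge0.
exact: normc2_top_coef_le.
Qed.

(** The exponent (s + 1) / m - 1 is at most 0, so the weight decreases with the modulus, and |1 + v|
    >= 1 - rho. *)
Lemma shifted_weight_le v : normc2 v < rho ^+ 2 ->
  power_weight m s (1 + v) <= power_weight m s (1 - rho)%:C.
Proof.
move=> vr; have m0 : (0 < m)%N by exact: leq_ltn_trans sm.
have r10 : 0 < 1 - rho by rewrite subr_gt0.
have nr : normc2 (1 - rho)%:C <= normc2 (1 + v).
  rewrite le_normc2 (le_trans _ (norm_add1_ge (r := rho) _))//.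
    by rewrite ger0_norm// ler0c ltW.
  by rewrite le_norm_real ?ltW.
have n0 : 0 < normc2 ((1 - rho)%:C : R[i]) by rewrite normc2_real exprn_gt0.
rewrite ler_expR ler_wnM2l//.
  by rewrite subr_le0 ler_pdivrMr ?ltr0n// mul1r ler_nat.
by rewrite ler_ln// posrE// (lt_le_trans n0).
Qed.

Lemma normc2_horner_bounded P : exists2 B, 0 <= B &
  forall v, normc2 v <= 1 -> normc2 P.[v] <= B.
Proof.
exists ((size P)%:R * \sum_(i < size P) normc2 P`_i).
  by rewrite mulr_ge0// sumr_ge0// => i _; exact: normc2_ge0.
move=> v v1; rewrite horner_coef.
rewrite (le_trans (normc2_sum_le (size P) (fun i => P`_i * v ^+ i)))//.
rewrite ler_wpM2l//; apply: ler_sum => i _.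
by rewrite normc2M normc2X ler_piMr ?normc2_ge0// exprn_ile1// normc2_ge0.
Qed.

Lemma weighted_norm2_le (d : R) : 0 < d ->
  exists C, exists N, exists eta, [/\ 0 < eta, eta < rho ^+ 2 & forall k, exists Q,
    [/\ size Q = (N + k).+1, Q`_(N + k) = 1 &
     (weighted_norm2 Q <= ((1 + d) ^+ 4 * (pi * (rho ^+ 2) ^+ (N + k).+1 / (N + k).+1%:R) +
       C * (pi * eta ^+ k.+1 / k.+1%:R))%:E)%E]].
Proof.
move=> d0; have rho20 : 0 < rho ^+ 2 by rewrite exprn_gt0.
have rho21 : rho ^+ 2 < 1 by rewrite exprn_ilt1// ltW.
have [T T0 [eta /andP[eta0 etar] TE]] := upper_approximant sm rho0 rho1 d0.
have T00 : T`_0 = 1 by rewrite -horner_coef0.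
have sT : (0 < size T)%N.
  rewrite lt0n size_poly_eq0; apply: contra_eq_neq T0 => ->.
  by rewrite horner0 eq_sym oner_neq0.
pose N := (size T).-1.
have sTN : size T = N.+1 by rewrite /N prednK.
pose r2 : R[i] := (rho ^+ 2)%:C.
(* The reversed polynomial v^N T(rho^2 / v), monic of degree [N] because T(0) = 1. *)
pose S : {poly R[i]} := \poly_(i < N.+1) (T`_(N - i) * r2 ^+ (N - i)).
have SE v : v != 0 -> S.[v] = v ^+ N * T.[r2 / v].
  move=> v0; rewrite horner_poly horner_coef sTN mulr_sumr.
  rewrite (reindex_inj rev_ord_inj)/=; apply: eq_bigr => i _.
  rewrite subSS subKn -1?ltnS// exprMn exprVn.
  have -> : v ^+ N = v ^+ (N - i) * v ^+ i by rewrite -exprD subnK// -ltnS.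
  by field; rewrite expf_neq0.
have SN : S`_N = 1 by rewrite coef_poly ltnSn subnn T00 mul1r.
have [B B0 BE] := normc2_horner_bounded S.
(* For |v|^2 < eta nothing cancels, and a crude bound on |S|^2 times a bound on the weight is
   enough: the resulting term decays like eta^k, with eta < rho^2. *)
exists (B * power_weight m s (1 - rho)%:C); exists N; exists eta; split => // k.
set W := power_weight m s _.
have W0 : 0 < W by exact: power_weight_gt0.
have sS : size S = N.+1 by rewrite size_poly_eq// subnn T00 mul1r oner_neq0.
exists (S * 'X^k); split.
- by rewrite size_mulXn -?size_poly_eq0 sS// addnC.
- by rewrite coefMXn addnC ltnNge leq_addr/= addKn.
have QE v : normc2 (S * 'X^k).[v] = normc2 v ^+ k * normc2 S.[v].
  by rewrite hornerM hornerXn normc2M normc2X mulrC.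
have mrad j (e : R) : measurable_fun setT (fun p : plane =>
    (if normc2 (complex_of p : R[i]) < e then normc2 (complex_of p) ^+ j else 0)%:E).
  apply/measurable_EFinP; apply: measurable_fun_ifT.
  - by apply: measurable_fun_ltr => //; exact: (measurable_normc2 measurable_complex_of).
  - exact: (measurable_funX _ (measurable_normc2 measurable_complex_of)).
  - exact: measurable_cst.
have rad0 j (e : R) (p : plane) :
    (0 <= (if normc2 (complex_of p : R[i]) < e then normc2 (complex_of p) ^+ j else 0)%:E)%E.
  by rewrite lee_fin; case: ifP => // _; rewrite exprn_ge0// normc2_ge0.
have d40 : 0 <= (1 + d) ^+ 4 by rewrite exprn_ge0// addr_ge0// ltW.
have BW0 : 0 <= B * W by rewrite mulr_ge0// ltW.
rewrite EFinD !EFinM -!EFinM [X in (_ <= X + _)%E]EFinM [X in (_ <= _ + X)%E]EFinM.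
rewrite -(ge0_integral_radial (N + k) rho20) -(ge0_integral_radial k eta0).
rewrite -!ge0_integralZl_EFin// -ge0_integralD//; last 4 first.
- by move=> p _; rewrite mule_ge0.
- exact: measurable_funeM.
- by move=> p _; rewrite mule_ge0.
- exact: measurable_funeM.
apply: ge0_le_integral => //.
- by move=> p _; rewrite lee_fin on_disk_ge0// => v; rewrite mulr_ge0 ?normc2_ge0// ltW ?power_weight_gt0.
- apply: measurable_on_disk; apply: measurable_funM.
    exact: measurable_normc2_horner.
  exact: measurable_shifted_weight.
- by apply: emeasurable_funD; apply: measurable_funeM.
move=> p _; rewrite -!EFinM -EFinD lee_fin /on_disk.
move: (complex_of p) => v; case: ifPn => [vr|vr]; last first.
  by rewrite mulr0 add0r mulr_ge0//; case: ifP => // _; rewrite exprn_ge0// normc2_ge0.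
rewrite QE; have [ve|ev] := ltP (normc2 v) eta.
  apply: (@le_trans _ _ (B * W * normc2 v ^+ k)); last first.
    by rewrite lerDr mulr_ge0// exprn_ge0// normc2_ge0.
  rewrite -mulrA mulrC ler_wpM2r ?exprn_ge0 ?normc2_ge0//.
  rewrite ler_pM ?normc2_ge0 ?(ltW (power_weight_gt0 _ _ _))//.
    by rewrite BE// ltW// (lt_trans vr).
  exact: shifted_weight_le.
have v0 : v != 0 by rewrite -normc2_gt0 (lt_le_trans eta0).
rewrite mulr0 addr0 SE// normc2M normc2X mulrA -exprD addnC -mulrA mulrC.
by rewrite ler_wpM2r ?exprn_ge0 ?normc2_ge0// TE// ltW.
Qed.

End weighted_disk.

Lemma size_comp_XaddC (K : fieldType) (q : {poly K}) (c : K) :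
  size (q \Po ('X + c%:P)) = size q.
Proof. by rewrite size_comp_poly2// size_XaddC. Qed.

Lemma coef_comp_XaddC (K : fieldType) (q : {poly K}) (c : K) (k : nat) :
  size q = k.+1 -> (q \Po ('X + c%:P))`_k = q`_k.
Proof.
move=> sq; have s2 : (1 < size ('X + c%:P)%R)%N by rewrite size_XaddC.
have := lead_coef_comp q s2.
by rewrite lead_coefXaddC expr1n mulr1 !lead_coefE size_comp_XaddC sq.
Qed.

(** * Transfer of the norm bounds from the disk to the lemniscate domain *)

Section lemniscate.
Local Open Scope complex_scope.
Context {R : realType}.
Notation plane := (measurableTypeR R * measurableTypeR R)%type.
Variables (m s : nat) (rho : R).
Hypotheses (sm : (s < m)%N) (rho0 : 0 < rho) (rho1 : rho < 1).
Implicit Types (v z : R[i]) (P Q q : {poly R[i]}).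

Definition lemniscate_norm2 P : \bar R :=
  (\int[area_measure]_p
    (if normc2 ((complex_of p : R[i]) ^+ m - 1) < rho ^+ 2
     then normc2 P.[complex_of p] else 0)%:E)%E.

Lemma measurable_on_lemniscate (f : R[i] -> R) :
  measurable_fun setT (fun p : plane => f (complex_of p)) ->
  measurable_fun setT (fun p : plane =>
    (if normc2 ((complex_of p : R[i]) ^+ m - 1) < rho ^+ 2
     then f (complex_of p) else 0)%:E).
Proof.
move=> mf; apply/measurable_EFinP; apply: measurable_fun_ifT.
- apply: measurable_fun_ltr => //; apply: measurable_normc2.
  apply: measurable_complexD; last exact: measurable_complex_cst.
  exact: (measurable_complexX _ measurable_complex_of).
- exact: mf.
- exact: measurable_cst.
Qed.

(** The substitution w = z^m absorbs |z|^(2s) into the weight; the translation w = 1 + v then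
    recentres the disk. *)
Lemma weighted_norm2_transport q :
  (m%:R%:E * lemniscate_norm2 ('X^s * (q \Po 'X^m)) =
   weighted_norm2 m s rho (q \Po ('X + 1%:P)))%E.
Proof.
have m0 : (0 < m)%N by exact: leq_ltn_trans sm.
pose F w := (if normc2 (w - 1) < rho ^+ 2 then normc2 q.[w] else 0)%:E.
have mF : measurable_fun setT (fun p : plane => F (complex_of p)).
  apply/measurable_EFinP; apply: measurable_fun_ifT.
  - apply: measurable_fun_ltr => //; apply: measurable_normc2.
    by apply: measurable_complexD; [exact: measurable_complex_of|exact: measurable_complex_cst].
  - exact: measurable_normc2_horner.
  - exact: measurable_cst.
have F0 w : (0 <= F w)%E by rewrite lee_fin; case: ifP => // _; exact: normc2_ge0.
have := ge0_integral_complexX mF F0 s m0.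
pose G w := (F w * (power_weight m s w)%:E)%E.
have mG : measurable_fun setT (fun p : plane => G (complex_of p)).
  by apply: emeasurable_funM; [exact: mF|apply/measurable_EFinP; exact: measurable_power_weight].
have G0 w : (0 <= G w)%E by rewrite mule_ge0// lee_fin ltW// power_weight_gt0.
rewrite -[X in _ = X -> _]/(\int[area_measure]_p G (complex_of p))%E.
rewrite -(ge0_integral_complexD mG G0 1).
have -> : (\int[area_measure]_p G (complex_of p + 1)%R)%E =
    weighted_norm2 m s rho (q \Po ('X + 1%:P)).
  apply: eq_integral => p _; rewrite /G /F /on_disk addrK -EFinM; congr EFin.
  rewrite horner_comp !hornerE addrC.
  by case: ifP => //; rewrite mul0r.
move=> <-; rewrite muleC; congr (_ * _)%E; apply: eq_integral => p _.
rewrite /F -EFinM; congr EFin.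
rewrite hornerM hornerXn horner_comp hornerXn normc2M normc2X mulrC.
by case: ifP => //; rewrite mul0r.
Qed.

(** Rotations by [m]-th roots of unity preserve z^m, hence the domain, so integrating
    [residue_part_le] shows that the part of [P] in the residue class [s] has norm at most that of
    [P]; the disk bound applies to that part. *)
Lemma lemniscate_norm2_ge (k : nat) P : size P = (k * m + s).+1 ->
  P`_(k * m + s) = 1 ->
  ((pi * (rho ^+ 2) ^+ k.+1 / k.+1%:R)%:E <= m%:R%:E * lemniscate_norm2 P)%E.
Proof.
move=> sP Pn; have m0 : (0 < m)%N by exact: leq_ltn_trans sm.
have mR : 0 < (m%:R : R) by rewrite ltr0n.
have [q [sq qk qP]] := residue_part_le sm sP Pn.
have sQ : size (q \Po ('X + 1%:P)) = k.+1 by rewrite size_comp_XaddC.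
have Qk : (q \Po ('X + 1%:P))`_k = 1 by rewrite coef_comp_XaddC.
apply: (le_trans (weighted_norm2_ge sm rho0 rho1 sQ Qk)).
rewrite -weighted_norm2_transport.
pose F z := (if normc2 (z ^+ m - 1) < rho ^+ 2 then normc2 P.[z] else 0)%:E.
have mF : measurable_fun setT (fun p : plane => F (complex_of p)).
  exact: (measurable_on_lemniscate (f := fun z => normc2 P.[z])
    (measurable_normc2_horner P)).
have F0 w : (0 <= F w)%E by rewrite lee_fin; case: ifP => // _; exact: normc2_ge0.
have mFr l : measurable_fun setT (fun p : plane => F (unit_root m ^+ l * complex_of p)%R).
  apply: (measurable_comp_complex mF); apply: measurable_complexM.
    exact: measurable_complex_cst.
  exact: measurable_complex_of.
have -> : (m%:R%:E * lemniscate_norm2 P =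
    \int[area_measure]_p \sum_(l < m) F (unit_root m ^+ l * complex_of p)%R)%E.
  rewrite ge0_integral_sum//.
  rewrite (eq_bigr (fun=> (\int[area_measure]_p F (complex_of p))%E)); last first.
    by move=> l _; apply: ge0_integral_unit_root.
  by rewrite sumr_const card_ord mule_natl.
have mL : measurable_fun setT (fun p : plane =>
    (if normc2 ((complex_of p : R[i]) ^+ m - 1) < rho ^+ 2
     then normc2 ('X^s * (q \Po 'X^m)).[complex_of p] else 0)%:E).
  exact: (measurable_on_lemniscate (f := fun z => normc2 ('X^s * (q \Po 'X^m)).[z])
    (measurable_normc2_horner _)).
rewrite /lemniscate_norm2 -ge0_integralZl_EFin//; last first.
  by move=> p _; rewrite lee_fin; case: ifP => // _; exact: normc2_ge0.
apply: ge0_le_integral => //.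
- by move=> p _; rewrite mule_ge0 ?lee_fin ?(ltW mR)//; case: ifP => // _; exact: normc2_ge0.
- exact: (measurable_funeM _ mL).
- exact: emeasurable_sum.
move=> p _; rewrite -EFinM /F sumEFin lee_fin; move: (complex_of p) => z.
under [X in _ <= X]eq_bigr do rewrite exprMn exprAC unit_root_expn// expr1n mul1r.
case: ifPn => _; last by rewrite mulr0 sumr_ge0.
by rewrite hornerM hornerXn horner_comp hornerXn normc2M normc2X.
Qed.

Lemma lemniscate_norm2_le (d : R) : 0 < d ->
  exists C, exists N, exists eta, [/\ 0 < eta, eta < rho ^+ 2 & forall k, exists P,
    [/\ size P = ((N + k) * m + s).+1, P`_((N + k) * m + s) = 1 &
     (m%:R%:E * lemniscate_norm2 P <=
       ((1 + d) ^+ 4 * (pi * (rho ^+ 2) ^+ (N + k).+1 / (N + k).+1%:R) +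
       C * (pi * eta ^+ k.+1 / k.+1%:R))%:E)%E]].
Proof.
move=> d0; have m0 : (0 < m)%N by exact: leq_ltn_trans sm.
have [C [N [eta [eta0 etar H]]]] := weighted_norm2_le sm rho0 rho1 d0.
exists C; exists N; exists eta; split => // k.
have [Q [sQ Qk QE]] := H k.
pose q := Q \Po ('X + (-1)%:P).
have Qq : Q = q \Po ('X + 1%:P).
  rewrite /q -comp_polyA comp_polyD comp_polyX comp_polyC -addrA -polyCD subrr.
  by rewrite addr0 comp_polyXr.
have sq : size q = (N + k).+1 by rewrite size_comp_XaddC.
have qk : q`_(N + k) = 1 by rewrite coef_comp_XaddC.
exists ('X^s * (q \Po 'X^m)); split; last first.
- by rewrite weighted_norm2_transport -Qq.
- rewrite coefXnM ltnNge leq_addl/= addnK coef_comp_poly_Xn//.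
  by rewrite dvdn_mull// mulnK.
have qX0 : q \Po 'X^m != 0.
  apply/eqP => /(congr1 (fun p : {poly R[i]} => p`_((N + k) * m))).
  rewrite coef_comp_poly_Xn// dvdn_mull// mulnK// qk coef0.
  by apply/eqP; exact: oner_neq0.
rewrite mulrC size_mulXn// addnC -[size (q \Po 'X^m)]prednK ?size_poly_gt0//.
by rewrite size_comp_poly sq size_polyXn.
Qed.

End lemniscate.

(** Used to make z conj(w) integrable as soon as both squared moduli are. *)
Lemma Re_mul_conj_le {R : realType} (z w : R[i]) :
  `|complex.Re (z * w^*%C)| <= normc2 z + normc2 w.
Proof.
case: z w => [a b] [c d]; rewrite /normc2/= ler_norml mulrN opprK.
have := (sqr_ge0 (a + c), sqr_ge0 (a - c), sqr_ge0 (b + d), sqr_ge0 (b - d)).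
by move=> [[[h1 h2] h3] h4]; apply/andP; split; nra.
Qed.

Lemma Im_mul_conj_le {R : realType} (z w : R[i]) :
  `|complex.Im (z * w^*%C)| <= normc2 z + normc2 w.
Proof.
case: z w => [a b] [c d]; rewrite /normc2/= ler_norml mulrN.
have := (sqr_ge0 (a + d), sqr_ge0 (a - d), sqr_ge0 (b + c), sqr_ge0 (b - c)).
by move=> [[[h1 h2] h3] h4]; apply/andP; split; nra.
Qed.

(** * Extremality of the Bergman polynomials *)

Section bergman_dot_algebra.
Local Open Scope complex_scope.
Context {R : realType}.
Notation plane := (measurableTypeR R * measurableTypeR R)%type.
Variables (m : nat) (rho : R).
Hypotheses (m0 : (0 < m)%N) (rho0 : 0 < rho) (rho1 : rho < 1).
Implicit Types (v z : R[i]) (P Q q : {poly R[i]}).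

Let G : set R[i] := [set z | `|z ^+ m - 1| < rho%:C].
Let D : set plane := [set p | G (complex_of p)].

Lemma lemniscate_mem (p : plane) :
  (p \in D) = (normc2 ((complex_of p : R[i]) ^+ m - 1) < rho ^+ 2).
Proof.
have E z : (`|z| < rho%:C) = (normc2 z < rho ^+ 2).
  rewrite norm_sqrt_normc2 ltcR -ltr_sqr ?nnegrE ?sqrtr_ge0 ?ltW//.
  by rewrite sqr_sqrtr// normc2_ge0.
by apply/idP/idP; rewrite inE /D /G/= E.
Qed.

Lemma measurable_lemniscate : measurable D.
Proof.
have -> : D = (fun p : plane => normc2 ((complex_of p : R[i]) ^+ m - 1) < rho ^+ 2)
    @^-1` [set true].
  apply/seteqP; split => p.
    by move=> Dp; rewrite /preimage/= -lemniscate_mem mem_set.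
  by rewrite /preimage/= -lemniscate_mem => /set_mem.
rewrite -[X in measurable X]setTI.
suff : measurable_fun setT
    (fun p : plane => normc2 ((complex_of p : R[i]) ^+ m - 1) < rho ^+ 2) by exact.
apply: measurable_fun_ltr => //; apply: measurable_normc2.
apply: measurable_complexD; last exact: measurable_complex_cst.
exact: (measurable_complexX _ measurable_complex_of).
Qed.

Lemma lemniscate_norm2E Q :
  lemniscate_norm2 m rho Q =
  (\int[area_measure]_(p in D) (normc2 Q.[complex_of p])%:E)%E.
Proof.
rewrite [RHS]integral_mkcond; apply: eq_integral => p _.
by rewrite patchE lemniscate_mem; case: ifP.
Qed.

(** Real-valued integrals go through [fine], which sends [+oo] to 0; finiteness is what makes the
    inner product carry the same information as the extended norm. *)
Lemma lemniscate_norm2_fin Q : (lemniscate_norm2 m rho Q < +oo)%E.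
Proof.
pose B := (size Q)%:R * \sum_(i < size Q) normc2 Q`_i * 4 ^+ i.
have B0 : 0 <= B.
  by rewrite mulr_ge0// sumr_ge0// => i _; rewrite mulr_ge0 ?normc2_ge0// exprn_ge0.
have BE z : normc2 z < 4 -> normc2 Q.[z] <= B.
  move=> z4; rewrite horner_coef.
  rewrite (le_trans (normc2_sum_le (size Q) (fun i => Q`_i * z ^+ i)))//.
  rewrite ler_wpM2l//; apply: ler_sum => i _.
  by rewrite normc2M normc2X ler_wpM2l ?normc2_ge0// lerXn2r ?nnegrE ?normc2_ge0// ltW.
(* |z| >= 2 would give |z^m| >= 2, against |z^m| <= 1 + |z^m - 1| < 2. *)
have D4 z : normc2 (z ^+ m - 1) < rho ^+ 2 -> normc2 z < 4.
  move=> zr; rewrite ltNge; apply/negP => z4.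
  have zm : 4 <= normc2 (z ^+ m).
    rewrite normc2X (le_trans z4)// -[leLHS]expr1 ler_weXn2l//.
    by rewrite (le_trans _ z4)// ler1n.
  have : `|z ^+ m| <= 1 + `|z ^+ m - 1|.
    by rewrite -{1}(subrK 1 (z ^+ m)) addrC (le_trans (ler_normD _ _))// normr1.
  have n2 : (2%:R : R)%:C <= `|z ^+ m|.
    rewrite norm_sqrt_normc2 lecR -ler_sqr ?nnegrE ?sqrtr_ge0//.
    by rewrite sqr_sqrtr ?normc2_ge0// -natrX.
  have n3 : normc2 (z ^+ m - 1) < 1 by rewrite (lt_trans zr)// exprn_ilt1// ltW.
  have n4 : `|z ^+ m - 1| < 1%:C.
    by rewrite norm_sqrt_normc2 ltcR -ltr_sqr ?nnegrE ?sqrtr_ge0// sqr_sqrtr ?normc2_ge0// expr1n.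
  move=> n5; have := lt_le_trans (le_lt_trans (le_trans n2 n5) _) (lexx (1%:C + 1%:C)).
  by rewrite ltrD2l n4 -rmorphD ltxx => /(_ isT).
apply: (@le_lt_trans _ _ (B%:E * (pi * 4 ^+ 1 / 1%:R)%:E)%E); last by rewrite -EFinM ltry.
rewrite -(ge0_integral_radial 0)// -ge0_integralZl_EFin//; last 2 first.
- by move=> p _; rewrite lee_fin; case: ifP.
- apply/measurable_EFinP; apply: measurable_fun_ifT.
  + by apply: measurable_fun_ltr => //; exact: (measurable_normc2 measurable_complex_of).
  + exact: measurable_cst.
  + exact: measurable_cst.
apply: ge0_le_integral => //.
- by move=> p _; rewrite lee_fin; case: ifP => // _; exact: normc2_ge0.
- exact: (@measurable_on_lemniscate _ m rho (fun z => normc2 Q.[z])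
    (measurable_normc2_horner Q)).
- apply: measurable_funeM; apply/measurable_EFinP; apply: measurable_fun_ifT.
  + by apply: measurable_fun_ltr => //; exact: (measurable_normc2 measurable_complex_of).
  + exact: measurable_cst.
  + exact: measurable_cst.
move=> p _; rewrite -EFinM lee_fin; case: ifP => [pD|_].
  by rewrite D4// expr0 mulr1 BE// D4.
by rewrite mulr_ge0//; case: ifP.
Qed.

Lemma lemniscate_norm2_fineK Q :
  (fine (lemniscate_norm2 m rho Q))%:E = lemniscate_norm2 m rho Q.
Proof.
rewrite fineK// ge0_fin_numE ?lemniscate_norm2_fin//.
by apply: integral_ge0 => x _; rewrite lee_fin; case: ifP => // _; exact: normc2_ge0.
Qed.

Definition integrable_complex (f : R[i] -> R[i]) :=
  area_measure.-integrable D (fun p => (complex.Re (f (complex_of p)))%:E) /\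
  area_measure.-integrable D (fun p => (complex.Im (f (complex_of p)))%:E).

Lemma area_integralE (f : R[i] -> R[i]) : area_integral G f =
  (\int[area_measure]_(p in D) complex.Re (f (complex_of p))) +i*
  (\int[area_measure]_(p in D) complex.Im (f (complex_of p))).
Proof. by []. Qed.

Lemma area_integralD f g : integrable_complex f -> integrable_complex g ->
  area_integral G (fun z => f z + g z) = area_integral G f + area_integral G g.
Proof.
move=> [f1 f2] [g1 g2]; rewrite !area_integralE; simpc; congr (_ +i* _).
  rewrite -RintegralD//; last exact: measurable_lemniscate.
  by congr Rintegral; apply/funext => p; case: (f _) => a b; case: (g _).
rewrite -RintegralD//; last exact: measurable_lemniscate.
by congr Rintegral; apply/funext => p; case: (f _) => a b; case: (g _).
Qed.

Lemma area_integralZ (c : R[i]) f : integrable_complex f ->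
  area_integral G (fun z => c * f z) = c * area_integral G f.
Proof.
have mD := measurable_lemniscate.
move=> [f1 f2]; rewrite !area_integralE; case: c => a b; simpc; congr (_ +i* _).
  rewrite -!RintegralZl// -RintegralB//; last 2 first.
  - exact: (integrableZl mD a f1).
  - exact: (integrableZl mD b f2).
  by congr Rintegral; apply/funext => p; case: (f _).
rewrite -!RintegralZl// -RintegralD//; last 2 first.
- exact: (integrableZl mD a f2).
- exact: (integrableZl mD b f1).
by congr Rintegral; apply/funext => p; case: (f _).
Qed.

Lemma area_integral_conj f : integrable_complex f ->
  area_integral G (fun z => (f z)^*%C) = (area_integral G f)^*%C.
Proof.
have mD := measurable_lemniscate.
move=> [f1 f2]; rewrite !area_integralE /=; congr (_ +i* _).
  by congr Rintegral; apply/funext => p; case: (f _).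
rewrite -mulN1r -RintegralZl//.
by congr Rintegral; apply/funext => p; case: (f _) => a b /=; rewrite mulN1r.
Qed.

Lemma integrable_mul_conj Q q :
  integrable_complex (fun z => Q.[z] * (q.[z])^*%C).
Proof.
have mD := measurable_lemniscate.
have mn P : measurable_fun D (fun p => (normc2 P.[complex_of p])%:E).
  by apply/measurable_EFinP/measurable_funTS; exact: measurable_normc2_horner.
have iN P : area_measure.-integrable D (fun p => (normc2 P.[complex_of p])%:E).
  apply/integrableP; split => //.
  under eq_integral do rewrite gee0_abs ?lee_fin ?normc2_ge0//.
  by rewrite -lemniscate_norm2E lemniscate_norm2_fin.
have iS := integrableD mD (iN Q) (iN q).
have [mR mI] := measurable_complexM (measurable_horner Q measurable_complex_of)
  (measurable_complex_conj (measurable_horner q measurable_complex_of)).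
split; apply: (le_integrable mD _ _ iS).
- by apply/measurable_EFinP; exact: measurable_funTS mR.
- move=> p _; rewrite !abse_EFin lee_fin (le_trans (Re_mul_conj_le _ _))//.
  by rewrite ler_norm.
- by apply/measurable_EFinP; exact: measurable_funTS mI.
- move=> p _; rewrite !abse_EFin lee_fin (le_trans (Im_mul_conj_le _ _))//.
  by rewrite ler_norm.
Qed.

Let dot Q q := bergman_dot G (horner Q) (horner q).

Lemma bergman_dotDl Q Q' q : dot (Q + Q') q = dot Q q + dot Q' q.
Proof.
rewrite /dot /bergman_dot -area_integralD; try exact: integrable_mul_conj.
by congr area_integral; apply/funext => z; rewrite hornerD mulrDl.
Qed.

Lemma bergman_dotZl c Q q : dot (c *: Q) q = c * dot Q q.
Proof.
rewrite /dot /bergman_dot -area_integralZ; last exact: integrable_mul_conj.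
by congr area_integral; apply/funext => z; rewrite hornerZ mulrA.
Qed.

Lemma bergman_dot_conj Q q : dot q Q = (dot Q q)^*%C.
Proof.
rewrite /dot /bergman_dot -area_integral_conj; last exact: integrable_mul_conj.
congr area_integral; apply/funext => z.
by rewrite mulrC; case: (Q.[z]) => a b; case: (q.[z]) => c d /=; simpc; congr (_ +i* _); ring.
Qed.

Lemma bergman_dot_self Q : dot Q Q = (fine (lemniscate_norm2 m rho Q))%:C.
Proof.
rewrite /dot /bergman_dot area_integralE lemniscate_norm2E; congr (_ +i* _).
  by congr (fine (integral _ _ _)); apply/funext => p; rewrite Re_mul_conj.
rewrite (_ : (fun p => _) = cst 0); last first.
  by apply/funext => p /=; case: (Q.[_]) => a b /=; ring.
by rewrite Rintegral_cst ?mul0r//; exact: measurable_lemniscate.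
Qed.

End bergman_dot_algebra.

Section extremality.
Local Open Scope complex_scope.
Context {R : realType}.
Variables (m : nat) (r : R).
Hypotheses (m0 : (0 < m)%N) (r0 : 0 < r) (r1 : r < 1).
Variable P : nat -> {poly R[i]}.
Hypothesis hP : bergman_polynomials (lemniscate_domain m r) P.
Implicit Types p q : {poly R[i]}.

Let rho := r ^+ m.
Let rho0 : 0 < rho. Proof. by rewrite exprn_gt0. Qed.
Let rho1 : rho < 1. Proof. by rewrite exprn_ilt1 ?(ltW r0)// -lt0n. Qed.
Let dot p q := bergman_dot (lemniscate_domain m r) (horner p) (horner q).

Let dotDl p p' q : dot (p + p') q = dot p q + dot p' q.
Proof. exact: (bergman_dotDl m0 rho0 rho1). Qed.

Let dotZl c p q : dot (c *: p) q = c * dot p q.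
Proof. exact: (bergman_dotZl m0 rho0 rho1). Qed.

Let dotC p q : dot q p = (dot p q)^*%C.
Proof. exact: (bergman_dot_conj m0 rho0 rho1). Qed.

Let dotE p : dot p p = (fine (lemniscate_norm2 m rho p))%:C.
Proof. exact: bergman_dot_self. Qed.

Let lambda := bergman_leading_coef P.

Lemma bergman_leading_coef_gt0 n : 0 < lambda n.
Proof. by case: hP => _ + _ => /(_ n); rewrite ltcE => /andP[_]. Qed.

Lemma bergman_leading_coefE n : (P n)`_n = (lambda n)%:C.
Proof.
case: hP => sP lP _; have := lP n; rewrite lead_coefE sP/= ltcE => /andP[/eqP I0 _].
by rewrite /lambda /bergman_leading_coef lead_coefE sP/=; move: I0; case: (_`_n) => a b /= ->.
Qed.

(** Induction on a degree bound k <= n with [n] fixed: [P k] has exact degree k, so a multiple of it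
    removes the coefficient of degree k from [p] and is itself orthogonal to [P n]. *)
Lemma bergman_dot_lower n p : (size p <= n)%N -> dot p (P n) = 0.
Proof.
case: (hP) => sP _ oP; elim: {1 3}n (leqnn n) p => [_ p|k IHk kn p pk].
  rewrite leqn0 size_poly_eq0 => /eqP ->.
  by rewrite -(scale0r 0) dotZl mul0r.
pose c := p`_k / (P k)`_k.
have pE : p = (p - c *: P k) + c *: P k by rewrite subrK.
rewrite pE dotDl dotZl [dot (P k) _]oP (negbTE (_ : k != n)) ?ltn_eqF// mulr0 addr0.
apply: IHk; first exact: ltnW.
have Pk0 : (P k)`_k != 0.
  rewrite bergman_leading_coefE -[0]/(0%:C) (inj_eq (@complexI _)).
  by rewrite gt_eqF// bergman_leading_coef_gt0.
apply/leq_sizeP => j kj; rewrite coefB coefZ.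
have [jk|jk] := eqVneq j k; first by rewrite jk /c divfK// subrr.
have kj' : (k < j)%N by rewrite ltn_neqAle eq_sym jk.
by rewrite !nth_default ?mulr0 ?subr0// ?sP// (leq_trans pk).
Qed.

(** Pythagoras: q = D + lambda^-1 P_n with [D] of lower degree, hence orthogonal to P_n, so the
    squared norm of [q] is that of [D] plus lambda^-2. *)
Lemma bergman_norm2_min n q : size q = n.+1 -> q`_n = 1 ->
  1 <= lambda n ^+ 2 * fine (lemniscate_norm2 m rho q).
Proof.
move=> sq qn; have l0 := bergman_leading_coef_gt0 n.
case: (hP) => sP _ oP.
pose c : R[i] := (lambda n)^-1%:C.
pose D := q - c *: P n.
have qE : q = D + c *: P n by rewrite subrK.
have DP : dot D (P n) = 0.
  apply: bergman_dot_lower; apply/leq_sizeP => j nj; rewrite coefB coefZ.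
  have [->|jn] := eqVneq j n.
    by rewrite qn bergman_leading_coefE -rmorphM mulVf ?gt_eqF// subrr.
  have nj' : (n < j)%N by rewrite ltn_neqAle eq_sym jn.
  by rewrite !nth_default ?mulr0 ?subr0// ?sP ?sq.
have PD : dot (P n) D = 0 by rewrite dotC DP conjc0.
have PP : dot (P n) (P n) = 1 by rewrite [LHS]oP eqxx.
have Pq : dot (P n) q = c.
  rewrite dotC {1}qE dotDl dotZl DP PP add0r mulr1.
  by rewrite conjc_real.
have Dq : dot D q = dot D D.
  by rewrite dotC {1}qE dotDl dotZl PD mulr0 addr0 -dotC.
have := dotE q; rewrite {1}qE dotDl dotZl Dq Pq dotE -rmorphM -rmorphD => /complexI <-.
rewrite mulrDr -expr2 -exprMn mulfV ?gt_eqF// expr1n lerDr mulr_ge0 ?sqr_ge0//.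
apply: fine_ge0; apply: integral_ge0 => x _.
by rewrite lee_fin; case: ifP => // _; exact: normc2_ge0.
Qed.

(** The monic multiple of [P n] attains the bound of [bergman_norm2_min], so lambda^-2 is the
    minimum. *)
Lemma bergman_norm2_monic n :
  let q := (lambda n)^-1%:C *: P n in
  [/\ size q = n.+1, q`_n = 1 & fine (lemniscate_norm2 m rho q) = (lambda n ^+ 2)^-1].
Proof.
move=> q; have l0 := bergman_leading_coef_gt0 n; case: (hP) => sP _ oP.
have c0 : (lambda n)^-1%:C != 0 :> R[i].
  by rewrite -[0]/(0%:C) (inj_eq (@complexI _)) invr_eq0 gt_eqF.
split.
- by rewrite /q size_scale.
- by rewrite /q coefZ bergman_leading_coefE -rmorphM mulVf ?gt_eqF.
apply: (@complexI R); rewrite -dotE /q dotZl dotC dotZl [dot (P n) _]oP eqxx mulr1.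
by rewrite conjc_real -rmorphM -expr2 exprVn.
Qed.

End extremality.

Lemma residue_exponent m s k : (s < m)%N ->
  (k * m + s + 1 + (m - s - 1))%N = (m * k.+1)%N.
Proof.
move=> sm; have e : (s + 1 + (m - s - 1))%N = m by lia.
by rewrite -!addnA addnA -addnA [(s + _)%N]addnA e mulnS mulnC addnC.
Qed.

(** * Asymptotics *)

Section asymptotics.
Context {R : realType}.
Variables (m s : nat) (r : R).
Hypotheses (sm : (s < m)%N) (r0 : 0 < r) (r1 : r < 1).
Variable P : nat -> {poly R[i]}.
Hypothesis hP : bergman_polynomials (lemniscate_domain m r) P.

Let m0 : (0 < m)%N. Proof. exact: leq_ltn_trans sm. Qed.
Let rho := r ^+ m.
Let rho0 : 0 < rho. Proof. by rewrite exprn_gt0. Qed.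
Let rho1 : rho < 1. Proof. by rewrite exprn_ilt1 ?(ltW r0)// -lt0n. Qed.
Let mR : 0 < m%:R :> R. Proof. by rewrite ltr0n. Qed.

Let lambda := bergman_leading_coef P.
Let A k : R := pi * (rho ^+ 2) ^+ k.+1 / k.+1%:R.

Let A0 k : 0 < A k.
Proof. by rewrite divr_gt0// mulr_gt0 ?pi_gt0// !exprn_gt0. Qed.

(** The lower bound [A k / m] for the squared norm, divided by the true minimum lambda^-2. *)
Let x k := lambda (k * m + s) ^+ 2 * A k / m%:R.

Lemma ratio_le1 k : x k <= 1.
Proof.
have [sq qn qE] := bergman_norm2_monic m0 r0 r1 hP (k * m + s).
have l0 := bergman_leading_coef_gt0 hP (k * m + s).
have := lemniscate_norm2_ge sm rho0 rho1 sq qn.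
rewrite -(lemniscate_norm2_fineK m0 rho0 rho1) qE -EFinM lee_fin -/(A k) => H.
by rewrite ler_pdivrMr// mul1r mulrC -ler_pdivlMr ?exprn_gt0.
Qed.

Lemma ratio_ge (d e : R) : 0 < d -> 0 < e ->
  \forall k \near \oo, 1 <= x k * ((1 + d) ^+ 4 + e).
Proof.
move=> d0 e0.
have [C [N [eta [eta0 etar H]]]] := lemniscate_norm2_le sm rho0 rho1 d0.
have rho20 : 0 < rho ^+ 2 by rewrite exprn_gt0.
pose q := eta / rho ^+ 2.
have q0 : 0 < q by rewrite divr_gt0.
have q1 : q < 1 by rewrite ltr_pdivrMr// mul1r.
(* With k = N + j, the tail divided by [A k] is C q^(j+1) / rho^(2N) times (k + 1) / (j + 1), and k
   + 1 <= (N + 1)(j + 1). *)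
pose K := `|C| * N.+1%:R / (rho ^+ 2) ^+ N.
have : (fun j => q ^+ j * K) @ \oo --> 0 * K.
  by apply: cvgMl; apply: cvg_expr; rewrite ger0_norm// ltW.
rewrite mul0r => /cvgrPdist_le/(_ _ e0) [J _ HJ].
exists (N + J)%N => // k /= kJ.
pose j := (k - N)%N.
have kE : k = (N + j)%N by rewrite subnKC// (leq_trans (leq_addr _ _) kJ).
have jJ : (J <= j.+1)%N by rewrite leqW// leq_subRL// (leq_trans (leq_addr _ _) kJ).
have [p [sp pn pE]] := H j.
rewrite -kE -/(A k) in sp pn pE.
have p1 := bergman_norm2_min m0 r0 r1 hP sp pn.
move: pE; rewrite -(lemniscate_norm2_fineK m0 rho0 rho1) -EFinM lee_fin => pE.
have l20 : 0 <= lambda (k * m + s) ^+ 2 by rewrite sqr_ge0.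
have tail : C * (pi * eta ^+ j.+1 / j.+1%:R) <= e * A k.
  have := HJ j.+1 jJ; rewrite /= sub0r normrN => He.
  have {}He : q ^+ j.+1 * K <= e := le_trans (ler_norm _) He.
  apply: (@le_trans _ _ (q ^+ j.+1 * K * A k)); last by rewrite ler_wpM2r// ltW.
  have -> : q ^+ j.+1 * K * A k =
      (pi * eta ^+ j.+1 / j.+1%:R) * (`|C| * (N.+1%:R * j.+1%:R / k.+1%:R)).
    rewrite /q /K /A kE -addnS exprD expr_div_n; field.
    by rewrite !expf_neq0 ?gt_eqF//= addnS -!natr1 !natr1 !pnatr_eq0.
  rewrite mulrC ler_wpM2l ?divr_ge0 ?mulr_ge0 ?pi_ge0 ?exprn_ge0 ?(ltW eta0)//.
  rewrite (le_trans (ler_norm C))// ler_peMr//.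
  rewrite ler_pdivlMr ?ltr0n// mul1r -natrM ler_nat kE.
  by rewrite mulSn -addnS addnC leq_add2l leq_pmulr.
have -> : x k * ((1 + d) ^+ 4 + e) =
    lambda (k * m + s) ^+ 2 * (((1 + d) ^+ 4 + e) * A k / m%:R) by rewrite /x; ring.
apply: (le_trans p1); apply: ler_wpM2l => //.
rewrite ler_pdivlMr// [leLHS]mulrC (le_trans pE)//.
by rewrite [leRHS]mulrDl; apply: lerD.
Qed.

Lemma ratio_cvg : x @ \oo --> (1 : R).
Proof.
apply/cvgrPdist_le => eps eps0.
(* For d <= 1, (1 + d)^4 <= 1 + 15 d, because 4 + 6 + 4 + 1 = 15, and 15 d <= eps / 2. *)
pose d := Num.min 1 (eps / 30).
have d0 : 0 < d by rewrite lt_min ltr01 divr_gt0.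
have d1 : d <= 1 by rewrite ge_min lexx.
have deps : 30 * d <= eps.
  by rewrite mulrC -ler_pdivlMr// ge_min lexx orbT.
have d2 : d ^+ 2 <= d by rewrite expr2 ler_piMl// ltW.
have d3 : d ^+ 3 <= d by rewrite exprS -[leRHS]mulr1 ler_wpM2l ?(ltW d0)// exprn_ile1// ltW.
have d4 : d ^+ 4 <= d by rewrite exprS -[leRHS]mulr1 ler_wpM2l ?(ltW d0)// exprn_ile1// ltW.
have e20 : 0 < eps / 2 by rewrite divr_gt0.
have [K _ HK] := ratio_ge d0 e20.
exists K => // k kK; have x1 := ratio_le1 k; have x2 := HK k kK.
rewrite ger0_norm ?subr_ge0//.
have x0 : 0 <= x k by rewrite divr_ge0 ?(ltW mR)// mulr_ge0 ?sqr_ge0// ltW.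
have dE : (1 + d) ^+ 4 + eps / 2 <= 1 + eps.
  rewrite (_ : (1 + d) ^+ 4 = 1 + 4 * d + 6 * d ^+ 2 + 4 * d ^+ 3 + d ^+ 4); last by ring.
  by lra.
have := le_trans x2 (ler_wpM2l x0 dE).
rewrite mulrDr mulr1 => H.
have xe : x k * eps <= eps by rewrite ler_piMl// ltW.
by lra.
Qed.

Let y k := lambda (k * m + s) * r ^+ (k * m + s + 1)
  * Num.sqrt (pi / (k * m + s + 1)%:R).

(** The identity r^(km+s+1) r^(m-s-1) = rho^(k+1) is the origin of the limit 1 / r^(m-s-1); the
    middle factor compares m (k + 1) with km + s + 1 and tends to 1. *)
Let y_sqr k : y k ^+ 2 =
  x k * (m%:R * k.+1%:R / (k * m + s + 1)%:R) / (r ^+ (m - s - 1)) ^+ 2.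
Proof.
have n0 : 0 < (k * m + s + 1)%:R :> R by rewrite ltr0n addn1.
rewrite /y /x /A !exprMn sqr_sqrtr ?divr_ge0 ?pi_ge0//.
have E : r ^+ (k * m + s + 1) * r ^+ (m - s - 1) = rho ^+ k.+1.
  by rewrite -exprD residue_exponent// exprM.
rewrite -{}E.
have R1 : r ^+ (m - s - 1) != 0 by rewrite expf_neq0 ?gt_eqF.
have k0 : k.+1%:R != 0 :> R by rewrite pnatr_eq0.
move: (r ^+ (m - s - 1)) (r ^+ (k * m + s + 1)) R1 => u v u0.
move: (k.+1%:R : R) k0 (m%:R : R) mR (lambda _) => K K0 M M0 l.
move: ((k * m + s + 1)%:R : R) n0 => L L0.
by field; rewrite u0 K0 !gt_eqF.
Qed.

Let index_ratio_cvg :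
  (fun k => m%:R * k.+1%:R / (k * m + s + 1)%:R : R) @ \oo --> (1 : R).
Proof.
(* km + s + 1 = m (k + 1) (1 - c / (k + 1)), and [harmonic k] is 1 / (k + 1). *)
pose c : R := (m - s - 1)%:R / m%:R.
have H : (fun k => (1 - c * harmonic k)^-1) @ \oo --> (1 - c * 0)^-1.
  apply: cvgV; first by rewrite mulr0 subr0 oner_neq0.
  by apply: cvgB; [exact: cvg_cst|apply: cvgMr; exact: cvg_harmonic].
rewrite mulr0 subr0 invr1 in H.
rewrite (_ : (fun k => _) = (fun k => (1 - c * harmonic k)^-1))//.
apply/funext => k.
have := congr1 (fun i => i%:R : R) (residue_exponent k sm).
rewrite /c /= natrD natrM => E.
have mn0 : m%:R != 0 :> R by rewrite gt_eqF.
have -> : 1 - (m - s - 1)%:R / m%:R * k.+1%:R^-1 =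
    (k * m + s + 1)%:R / (m%:R * k.+1%:R) :> R.
  rewrite -mulrA -invfM -[X in X - _](@divff _ (m%:R * k.+1%:R : R)) ?mulf_neq0//.
  by rewrite -mulrBl -[X in X - _]E addrK.
by rewrite invf_div.
Qed.

Lemma bergman_leading_coef_cvg :
  y @ \oo --> 1 / r ^+ (m - s - 1).
Proof.
have y0 k : 0 <= y k.
  rewrite !mulr_ge0 ?sqrtr_ge0 ?exprn_ge0 ?(ltW r0)//.
  by rewrite ltW// (bergman_leading_coef_gt0 hP).
have q0 : 0 <= 1 / r ^+ (m - s - 1) by rewrite divr_ge0// exprn_ge0// ltW.
(* As [y] is nonnegative, the limit can be computed on squares, where the ratio [x] appears, and
   brought back by continuity of the square root. *)
have -> : y = (fun k => Num.sqrt (y k ^+ 2)).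
  by apply/funext => k; rewrite sqrtr_sqr ger0_norm.
rewrite -[X in _ --> X](ger0_norm q0) -sqrtr_sqr.
apply: (@continuous_cvg _ _ _ _ _ (fun k => y k ^+ 2)); first exact: sqrt_continuous.
under eq_fun do rewrite y_sqr.
rewrite expr_div_n expr1n -[X in X / _](mul1r 1).
by apply: cvgMl; apply: cvgM; [exact: ratio_cvg|exact: index_ratio_cvg].
Qed.

End asymptotics.

Theorem proposition7p1 (R : realType) (m : nat) (hm : (2 <= m)%N)
    (r : R) (hr0 : 0 < r) (hr1 : r < 1)
    (P : nat -> {poly R[i]})
    (hP : bergman_polynomials (lemniscate_domain m r) P)
    (s : nat) (hs : (s < m)%N) :
  (fun k : nat => bergman_leading_coef P (k * m + s)%N * r ^+ (k * m + s + 1)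
      * Num.sqrt (pi / (k * m + s + 1)%:R)) @ \oo
    --> 1 / r ^+ (m - s - 1).
Proof. exact: bergman_leading_coef_cvg hs hr0 hr1 P hP. Qed.
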